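(* Let $\Bbbk$ be a commutative unital ring and $A$ a $\Bbbk$-superalgebra, free of finite rank. Let $(e^{\bar0},e^{\bar1})$ be an adapted pair of idempotents in $A$, and let $\{e_i\mid i\in I^{\bar0}\}$, $\{e_i\mid i\in I^{\bar1}\}$ be finite families of non-zero orthogonal idempotents with $e^{\bar0}=\sum_{i\in I^{\bar0}}e_i$ and $e^{\bar1}=\sum_{i\in I^{\bar1}}e_i$, such that each $e_iA$ is a free $\Bbbk$-supermodule with a finite homogeneous basis. Put $I=I^{\bar0}\sqcup I^{\bar1}=\{1,\dots,l\}$. Let $d\ge0$, $n\ge1$. Then the map $\psi\colon|S^A(n,d)|\to\mathrm{End}_{W_d^{|A|}}(M^{|A|}(n,d))$ defined in the context is an algebra isomorphism.
   Context: Adapted: $e^{\bar0},e^{\bar1}$ are orthogonal idempotents with $1_A=e^{\bar0}+e^{\bar1}$, $A_{\bar0}=e^{\bar0}Ae^{\bar0}\oplus e^{\bar1}Ae^{\bar1}$ and $A_{\bar1}=e^{\bar0}Ae^{\bar1}\oplus e^{\bar1}Ae^{\bar0}$. Super conventions. $\bar v\in\mathbb Z_2=\{\bar0,\bar1\}$ is the parity of homogeneous $v$; formulas with parities are for homogeneous elements, extended linearly. Put $[u_1,\dots,u_d;w_1,\dots,w_d]=\sum_{a<c}\bar u_c\bar w_a$. Tensor powers of superalgebras multiply by $(x_1\otimes\cdots\otimes x_d)(y_1\otimes\cdots\otimes y_d)=(-1)^{[x_1,\dots,x_d;y_1,\dots,y_d]}x_1y_1\otimes\cdots\otimes x_dy_d$.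 $\mathfrak S_d$ acts on the right on $V^{\otimes d}$ by $(v_1\otimes\cdots\otimes v_d)^g=(-1)^mv_{g1}\otimes\cdots\otimes v_{gd}$, $m=\sum_{a<c,\,g^{-1}a>g^{-1}c}\bar v_a\bar v_c$. $|B|$ is a superalgebra $B$ with the $\mathbb Z_2$-grading forgotten. $S^A(n,d)=(M_n(A)^{\otimes d})^{\mathfrak S_d}$ (parity of matrices determined by entries). $W_d^A=A^{\otimes d}\rtimes\Bbbk\mathfrak S_d$ with $g^{-1}xg=x^g$ for $x\in A^{\otimes d}$; $W_d^{|A|}$ is the ordinary wreath product with $\mathfrak S_d$ permuting tensor factors without signs. For $x\in A$, $x[t]=1^{\otimes t-1}\otimes x\otimes1^{\otimes d-t}$. The isomorphism $\sigma\colon W_d^{|A|}\to|W_d^A|$ of algebras is determined by $x[t]\mapsto\sum_{\epsilon_1,\dots,\epsilon_{t-1}\in\mathbb Z_2}(-1)^{(\epsilon_1+\cdots+\epsilon_{t-1})\bar x}e^{\epsilon_1}\otimes\cdots\otimes e^{\epsilon_{t-1}}\otimes x\otimes1^{\otimes d-t}$ and $\tau_r=(r,r+1)\mapsto\tau_r(e^{\bar0,\bar0}[r]+e^{\bar0,\bar1}[r]+e^{\bar1,\bar0}[r]-e^{\bar1,\bar1}[r])$, where $e^{\epsilon,\epsilon'}[r]=e^\epsilon[r]e^{\epsilon'}[r+1]$. Colored permutation modules. $\Lambda([1,n]\times I,d)$ is the set of tuples $\boldsymbol\lambda=(\lambda_r^{(i)})_{(r,i)\in[1,n]\times I}$ of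 non-negative integers with sum $d$; $[1,n]\times I$ is ordered lexicographically. $\mathfrak S_{\boldsymbol\lambda}=\prod_{(r,i)}\mathfrak S_{\lambda_r^{(i)}}\le\mathfrak S_d$ is the standard parabolic subgroup preserving consecutive segments of $[1,d]$ of sizes $\lambda_r^{(i)}$ in lexicographic order; $e_{\boldsymbol\lambda}=\bigotimes_{(r,i)}e_i^{\otimes\lambda_r^{(i)}}$ (same order). Put $\zeta_i=1$ for $i\in I^{\bar0}$, $\zeta_i=-1$ for $i\in I^{\bar1}$, and $\varepsilon_{\boldsymbol\lambda}((g_r^{(i)}))=\prod_{(r,i)}\zeta_i^{\ell(g_r^{(i)})}$ on $\mathfrak S_{\boldsymbol\lambda}$, $\ell$ the length. $W_{\boldsymbol\lambda}^{|A|}=e_{\boldsymbol\lambda}\otimes\Bbbk\mathfrak S_{\boldsymbol\lambda}\subseteq W_d^{|A|}$ (identity $e_{\boldsymbol\lambda}$); $\mathtt{alt}_{\boldsymbol\lambda}=\Bbbk\cdot1_{\boldsymbol\lambda}$ is its right module with $1_{\boldsymbol\lambda}(e_{\boldsymbol\lambda}\otimes g)=\varepsilon_{\boldsymbol\lambda}(g)1_{\boldsymbol\lambda}$; $M_{\boldsymbol\lambda}^{|A|}=\mathtt{alt}_{\boldsymbol\lambda}\otimes_{W_{\boldsymbol\lambda}^{|A|}}e_{\boldsymbol\lambda}W_d^{|A|}$ with generator $m_{\boldsymbol\lambda}^{|A|}=1_{\boldsymbol\lambda}\otimes e_{\boldsymbol\lambda}$; $M^{|A|}(n,d)=\bigoplus_{\boldsymbol\lambda\in\Lambda([1,n]\times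 I,d)}M_{\boldsymbol\lambda}^{|A|}$. Definition of $\psi$. $V=A^{\oplus n}$ (column vectors). $M_n(A)^{\otimes d}\supseteq S^A(n,d)$ acts on the left on $V^{\otimes d}$ by $(\xi_1\otimes\cdots\otimes\xi_d)(v_1\otimes\cdots\otimes v_d)=(-1)^{[\xi_1,\dots,\xi_d;v_1,\dots,v_d]}\xi_1v_1\otimes\cdots\otimes\xi_dv_d$; $W_d^A$ acts on the right by $(v_1\otimes\cdots\otimes v_d)(a_1\otimes\cdots\otimes a_d)=(-1)^{[v_1,\dots,v_d;a_1,\dots,a_d]}v_1a_1\otimes\cdots\otimes v_da_d$ and $vg=v^g$. Let $v_{r,i}\in V$ have $e_i$ in position $r$ and zeros elsewhere, and $v_{\boldsymbol\lambda}=\bigotimes_{(r,i)}v_{r,i}^{\otimes\lambda_r^{(i)}}$ (lexicographic order). For $y\in S^A(n,d)$ one can write $yv_{\boldsymbol\lambda}=\sum_{\boldsymbol\mu}v_{\boldsymbol\mu}h_{\boldsymbol\mu,\boldsymbol\lambda}$ with $h_{\boldsymbol\mu,\boldsymbol\lambda}\in W_d^A$; $\psi(y)$ is the (well-defined) $W_d^{|A|}$-endomorphism of $M^{|A|}(n,d)$ with $\psi(y)(m_{\boldsymbol\lambda}^{|A|})=\sum_{\boldsymbol\mu}m_{\boldsymbol\mu}^{|A|}\sigma^{-1}(h_{\boldsymbol\mu,\boldsymbol\lambda})$ for all $\boldsymbol\lambda$. *)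

(* Defs.v *)
From HB Require Import structures.
From mathcomp Require Import all_boot perm all_algebra.
From mathcomp Require Import fingroup action generic_quotient boolp.

Set Implicit Arguments.
Unset Strict Implicit.
Unset Printing Implicit Defensive.

Import GRing.Theory.
Local Open Scope ring_scope.
Local Open Scope quotient_scope.

(* Parities are booleans, [false] being even: addition in Z/2 is [addb] and
   multiplication is [andb].  [hpart b] is the projection to the component of
   parity [b]. *)
HB.mixin Record isSupermodule (k : comPzRingType) V of GRing.Lmodule k V := {
  hpart : bool -> V -> V;
  hpart_linear : forall b, linear (hpart b);
  hpartK : forall b c x, hpart b (hpart c x) = if b == c then hpart c x else 0;
  hpartD : forall x, hpart false x + hpart true x = x
}.
#[short(type="supermodType")]
HB.structure Definition Supermodule (k : comPzRingType) :=
  {V of GRing.Lmodule k V & isSupermodule k V}.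

HB.instance Definition _ (k : comPzRingType) (V : supermodType k) (b : bool) :=
  GRing.isLinear.Build k V V *:%R (hpart b) (hpart_linear b).

Definition homog (k : comPzRingType) (V : supermodType k) (b : bool) (x : V) :=
  hpart b x = x.

(* A plain record over [pzRingType] rather than an extension of [algType]:
   the latter excludes the zero algebra. *)
Record superalg (k : comPzRingType) := Superalg {
  sa_ring : pzRingType;
  sa_scale : k -> sa_ring -> sa_ring;
  sa_scaleA : forall a b x, sa_scale a (sa_scale b x) = sa_scale (a * b) x;
  sa_scale1 : left_id 1 sa_scale;
  sa_scaleDr : right_distributive sa_scale +%R;
  sa_scaleDl : forall x, {morph sa_scale^~ x : a b / a + b};
  sa_scaleAl : forall c x y, sa_scale c (x * y) = sa_scale c x * y;
  sa_scaleAr : forall c x y, sa_scale c (x * y) = x * sa_scale c y;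
  sa_part : bool -> sa_ring -> sa_ring;
  sa_partP : forall b c x y,
    sa_part b (sa_scale c x + y) = sa_scale c (sa_part b x) + sa_part b y;
  sa_partK : forall b c x,
    sa_part b (sa_part c x) = if b == c then sa_part c x else 0;
  sa_partD : forall x, sa_part false x + sa_part true x = x;
  sa_partM : forall b c x y,
    sa_part (b (+) c) (sa_part b x * sa_part c y) = sa_part b x * sa_part c y
}.
Definition sa_sort (k : comPzRingType) (A : superalg k) : Type := sa_ring A.
Coercion sa_sort : superalg >-> Sortclass.

HB.instance Definition _ (k : comPzRingType) (A : superalg k) :=
  GRing.PzRing.copy (sa_sort A) (sa_ring A).
HB.instance Definition _ (k : comPzRingType) (A : superalg k) :=
  GRing.Zmodule_isLmodule.Build k (sa_sort A)
    (@sa_scaleA k A) (@sa_scale1 k A) (@sa_scaleDr k A) (@sa_scaleDl k A).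
HB.instance Definition _ (k : comPzRingType) (A : superalg k) :=
  isSupermodule.Build k (sa_sort A)
    (@sa_partP k A) (@sa_partK k A) (@sa_partD k A).

Notation is_alg_iso f :=
  [/\ linear f, GRing.monoid_morphism f & bijective f] (only parsing).

Section SuperTheory.
Variable k : comPzRingType.

Lemma sascaleAl (A : superalg k) (c : k) (x y : A) : c *: (x * y) = (c *: x) * y.
Proof. exact: sa_scaleAl. Qed.
Lemma sascaleAr (A : superalg k) (c : k) (x y : A) : c *: (x * y) = x * (c *: y).
Proof. exact: sa_scaleAr. Qed.

Lemma homog_hpart (V : supermodType k) b (x : V) : homog b (hpart b x).
Proof. by rewrite /homog hpartK eqxx. Qed.

Lemma hpart_homog (V : supermodType k) b c (x : V) :
  homog c x -> hpart b x = if b == c then x else 0.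
Proof. by move=> <-; rewrite hpartK. Qed.

Lemma homogM (A : superalg k) b c (x y : A) :
  homog b x -> homog c y -> homog (b (+) c) (x * y).
Proof. by move=> <- <-; exact: sa_partM. Qed.

Lemma homog1 (A : superalg k) : homog false (1 : A).
Proof.
suff H b (x : A) : homog b x -> x * hpart false (1 : A) = x.
  suff e : (1 : A) = hpart false (1 : A) by rewrite e; exact: homog_hpart.
  rewrite -[RHS]mul1r -[X in X * _](hpartD (1 : A)) mulrDl.
  by rewrite !(H _ _ (homog_hpart _ _)) hpartD.
move=> hx; have h0 := homogM hx (homog_hpart false (1 : A)).
have h1 := homogM hx (homog_hpart true (1 : A)).
have e : x = x * hpart false (1 : A) + x * hpart true (1 : A) by rewrite -mulrDr hpartD mulr1.
have := congr1 (hpart b) e.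
rewrite hx raddfD /= (hpart_homog b h0) (hpart_homog b h1).
by case: b {hx h0 h1 e} => /=; rewrite addr0.
Qed.

End SuperTheory.

(* |A|: everything is even, so that all the signs in the constructions below
   are trivial for it. *)
Definition ungraded (k : comPzRingType) (A : superalg k) : superalg k.
Proof.
refine (@Superalg k (sa_ring A) (@sa_scale k A) (@sa_scaleA k A) (@sa_scale1 k A)
  (@sa_scaleDr k A) (@sa_scaleDl k A) (@sa_scaleAl k A) (@sa_scaleAr k A)
  (fun b x => if b then 0 else x) _ _ _ _).
- move=> [] c x y //=; rewrite addr0.
  exact/esym/(scaler0 (sa_sort A)).
- by case; case.
- by move=> x; rewrite addr0.
- by case; case=> x y; rewrite ?mul0r ?mulr0.
Defined.

(* Matrices over A as a k-supermodule; the library's scalar multiplication on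
   ['M[A]_(m, n)] is by A instead. *)
Definition smx (k : comPzRingType) (A : superalg k) (m n : nat) : Type :=
  'M[A]_(m, n).

Section SuperMatrix.
Variables (k : comPzRingType) (A : superalg k).

Section Rect.
Variables m n : nat.
HB.instance Definition _ := GRing.Zmodule.copy (smx A m n) 'M[A]_(m, n).

Definition smx_scale (c : k) (x : smx A m n) : smx A m n := map_mx ( *:%R c) x.
Fact smx_scaleA a b x : smx_scale a (smx_scale b x) = smx_scale (a * b) x.
Proof. by apply/matrixP=> i j; rewrite !mxE scalerA. Qed.
Fact smx_scale1 : left_id 1 smx_scale.
Proof. by move=> x; apply/matrixP=> i j; rewrite !mxE scale1r. Qed.
Fact smx_scaleDr : right_distributive smx_scale +%R.
Proof. by move=> a x y; apply/matrixP=> i j; rewrite !mxE scalerDr. Qed.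
Fact smx_scaleDl x : {morph smx_scale^~ x : a b / a + b}.
Proof. by move=> a b; apply/matrixP=> i j; rewrite !mxE scalerDl. Qed.
HB.instance Definition _ := GRing.Zmodule_isLmodule.Build k (smx A m n)
  smx_scaleA smx_scale1 smx_scaleDr smx_scaleDl.

Lemma smxZE c (x : smx A m n) i j :
  (c *: x : smx A m n) i j = c *: (x i j).
Proof. by rewrite mxE. Qed.

Definition smx_part (b : bool) (x : smx A m n) : smx A m n := map_mx (hpart b) x.
Fact smx_part_linear b : linear (smx_part b).
Proof.
by move=> c x y; apply/matrixP=> i j; rewrite !(mxE, smxZE) linearP.
Qed.
Fact smx_partK b c x : smx_part b (smx_part c x) = if b == c then smx_part c x else 0.
Proof.
apply/matrixP=> i j; rewrite !mxE hpartK.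
by case: eqP => _; rewrite !mxE.
Qed.
Fact smx_partD x : smx_part false x + smx_part true x = x.
Proof. by apply/matrixP=> i j; rewrite !mxE hpartD. Qed.
HB.instance Definition _ :=
  isSupermodule.Build k (smx A m n) smx_part_linear smx_partK smx_partD.

Lemma smx_homogP b (x : smx A m n) :
  homog b x <-> forall i j, homog b (x i j).
Proof.
split=> [/matrixP h i j|h]; first by have := h i j; rewrite mxE.
by apply/matrixP=> i j; rewrite mxE; exact: h.
Qed.
End Rect.

Section Mul.
Variables m n p : nat.

Definition smul (x : smx A m n) (y : smx A n p) : smx A m p := x *m y.

Lemma smulPl (y : smx A n p) : linear (smul^~ y).
Proof.
move=> c x x'; apply/matrixP=> i j; rewrite !(mxE, smxZE) scaler_sumr.
rewrite -big_split /=; apply: eq_bigr => s _.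
by rewrite !(mxE, smxZE) mulrDl sascaleAl.
Qed.
Lemma smulPr (x : smx A m n) : linear (smul x).
Proof.
move=> c y y'; apply/matrixP=> i j; rewrite !(mxE, smxZE) scaler_sumr.
rewrite -big_split /=; apply: eq_bigr => s _.
by rewrite !(mxE, smxZE) mulrDr sascaleAr.
Qed.
Lemma homog_smul b c (x : smx A m n) (y : smx A n p) :
  homog b x -> homog c y -> homog (b (+) c) (smul x y).
Proof.
move=> /smx_homogP hx /smx_homogP hy; apply/smx_homogP => i j.
rewrite mxE /homog raddf_sum; apply: eq_bigr => s _.
exact: homogM.
Qed.
End Mul.

Lemma smul_scaleAl n c (x y : smx A n n) : c *: smul x y = smul (c *: x) y.
Proof. by have := smulPl y c x 0; rewrite [smul 0 y]mul0mx !addr0. Qed.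
Lemma smul_scaleAr n c (x y : smx A n n) : c *: smul x y = smul x (c *: y).
Proof. by have := smulPr x c y 0; rewrite [smul x 0]mulmx0 !addr0. Qed.
Lemma smul_part n b c (x y : smx A n n) :
  hpart (b (+) c) (smul (hpart b x) (hpart c y)) = smul (hpart b x) (hpart c y).
Proof. by apply: homog_smul; apply: homog_hpart. Qed.

Definition Msuper (n : nat) : superalg k :=
  @Superalg k 'M[A]_n (@smx_scale n n) (@smx_scaleA n n) (@smx_scale1 n n)
    (@smx_scaleDr n n) (@smx_scaleDl n n) (@smul_scaleAl n) (@smul_scaleAr n)
    (@smx_part n n) (@smx_part_linear n n) (@smx_partK n n) (@smx_partD n n)
    (@smul_part n).

Definition scalr (m n : nat) (v : smx A m n) (a : A) : smx A m n :=
  map_mx ( *%R^~ a) v.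

End SuperMatrix.

(* The k-module universal for a class [good] of maps from X to k-modules:
   formal sums over X, identified when all the good maps agree on them. *)
Section Universal.
Variables (k : comPzRingType) (X : choiceType).

Definition fsum (V : lmodType k) (phi : X -> V) (s : seq (k * X)) : V :=
  \sum_(u <- s) u.1 *: phi u.2.

Variable good : forall V : lmodType k, (X -> V) -> Prop.

Definition ueq (s t : seq (k * X)) : bool :=
  `[< forall (V : lmodType k) (phi : X -> V),
        good phi -> fsum phi s = fsum phi t >].

Fact ueq_refl : reflexive ueq. Proof. by move=> s; apply/asboolP. Qed.
Fact ueq_sym : symmetric ueq.
Proof.
by move=> s t; apply/asboolP/asboolP => h V phi g; rewrite (h V phi g).
Qed.
Fact ueq_trans : transitive ueq.
Proof.
move=> t s r /asboolP h /asboolP h'; apply/asboolP => V phi g.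
by rewrite (h V phi g) (h' V phi g).
Qed.
Canonical ueq_equiv := EquivRel ueq ueq_refl ueq_sym ueq_trans.

Definition umod : Type := {eq_quot ueq_equiv}.
HB.instance Definition _ := Choice.on umod.
HB.instance Definition _ := EqQuotient.on umod.

Definition uin (x : X) : umod := \pi_umod [:: (1, x)].
Definition ulift (V : lmodType k) (phi : X -> V) (u : umod) : V :=
  fsum phi (repr u).

Lemma ulift_pi (V : lmodType k) (phi : X -> V) (s : seq (k * X)) :
  good phi -> ulift phi (\pi_umod s) = fsum phi s.
Proof.
move=> g; rewrite /ulift.
have /eqmodP/asboolP : repr (\pi_umod s) = s %[mod umod] by rewrite reprK.
exact.
Qed.

Lemma umodP (u v : umod) :
  (forall (V : lmodType k) (phi : X -> V), good phi -> ulift phi u = ulift phi v) ->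
  u = v.
Proof.
by rewrite -[u]reprK -[v]reprK => h; apply/eqmodP/asboolP => V phi g;
   have := h V phi g; rewrite !ulift_pi.
Qed.

Lemma fsum_cat (V : lmodType k) (phi : X -> V) s t :
  fsum phi (s ++ t) = fsum phi s + fsum phi t.
Proof. by rewrite /fsum big_cat. Qed.

Let fscale (c : k) (s : seq (k * X)) := [seq (c * u.1, u.2) | u <- s].

Lemma fsum_scale (V : lmodType k) (phi : X -> V) c s :
  fsum phi (fscale c s) = c *: fsum phi s.
Proof.
rewrite /fsum big_map scaler_sumr; apply: eq_bigr => u _ /=.
by rewrite scalerA.
Qed.

Let uzero : umod := \pi_umod [::].
Let uadd (u v : umod) : umod := \pi_umod (repr u ++ repr v).
Let uscale (c : k) (u : umod) : umod := \pi_umod (fscale c (repr u)).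
Let uopp := uscale (-1).

Section Lift.
Variables (V : lmodType k) (phi : X -> V) (g : good phi).
Fact ulift0 : ulift phi uzero = 0.
Proof. by rewrite ulift_pi // /fsum big_nil. Qed.
Fact uliftD u v : ulift phi (uadd u v) = ulift phi u + ulift phi v.
Proof. by rewrite ulift_pi // fsum_cat. Qed.
Fact uliftZ c u : ulift phi (uscale c u) = c *: ulift phi u.
Proof. by rewrite ulift_pi // fsum_scale. Qed.
End Lift.

Fact uaddA : associative uadd.
Proof. by move=> u v w; apply: umodP => V phi g; rewrite !uliftD // addrA. Qed.
Fact uaddC : commutative uadd.
Proof. by move=> u v; apply: umodP => V phi g; rewrite !uliftD // addrC. Qed.
Fact uadd0 : left_id uzero uadd.
Proof. by move=> u; apply: umodP => V phi g; rewrite uliftD // ulift0 // add0r. Qed.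
Fact uaddN : left_inverse uzero uopp uadd.
Proof.
move=> u; apply: umodP => V phi g.
by rewrite uliftD // ulift0 // uliftZ // scaleN1r addNr.
Qed.
HB.instance Definition _ := GRing.isZmodule.Build umod uaddA uaddC uadd0 uaddN.
Fact uscaleA a b u : uscale a (uscale b u) = uscale (a * b) u.
Proof. by apply: umodP => V phi g; rewrite !uliftZ // scalerA. Qed.
Fact uscale1 : left_id 1 uscale.
Proof. by move=> u; apply: umodP => V phi g; rewrite uliftZ // scale1r. Qed.
Fact uscaleDr : right_distributive uscale +%R.
Proof.
by move=> a u v; apply: umodP => V phi g; rewrite !(uliftZ, uliftD) // scalerDr.
Qed.
Fact uscaleDl u : {morph uscale^~ u : a b / a + b}.
Proof.
by move=> a b; apply: umodP => V phi g; rewrite !(uliftZ, uliftD) // scalerDl.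
Qed.
HB.instance Definition _ := GRing.Zmodule_isLmodule.Build k umod
  uscaleA uscale1 uscaleDr uscaleDl.

Lemma ulift_linear (V : lmodType k) (phi : X -> V) : good phi -> linear (ulift phi).
Proof. by move=> g c u v; rewrite uliftD // uliftZ. Qed.

Lemma ulift_uin (V : lmodType k) (phi : X -> V) x :
  good phi -> ulift phi (uin x) = phi x.
Proof. by move=> g; rewrite ulift_pi // /fsum big_seq1 scale1r. Qed.

Lemma linear_fsum (U V : lmodType k) (f : U -> V) (phi : X -> U) s :
  linear f -> f (fsum phi s) = fsum (f \o phi) s.
Proof.
move=> lf.
pose F : {linear U -> V} := HB.pack f (GRing.isLinear.Build _ _ _ _ _ lf).
rewrite -[f]/(F : U -> V) /fsum linear_sum; apply: eq_bigr => c _.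
by rewrite linearZ.
Qed.

Lemma umodE (u : umod) : u = fsum uin (repr u).
Proof.
apply: umodP => V phi g; rewrite (linear_fsum _ _ (ulift_linear g)).
by apply: eq_bigr => c _ /=; rewrite ulift_uin.
Qed.

Lemma umod_ext (V : lmodType k) (f h : umod -> V) : linear f -> linear h ->
  (forall x, f (uin x) = h (uin x)) -> f =1 h.
Proof.
move=> lf lh fh u; rewrite [u]umodE !linear_fsum //.
by apply: eq_bigr => c _ /=; rewrite fh.
Qed.

End Universal.

Section Multilinear.
Variables (k : comPzRingType) (d : nat).

Definition upd (V : Type) (x : {ffun 'I_d -> V}) (a : 'I_d) (u : V) :=
  [ffun b => if b == a then u else x b].

Definition multilinear (V W : lmodType k) (phi : {ffun 'I_d -> V} -> W) :=
  forall (a : 'I_d) (x : {ffun 'I_d -> V}), linear (fun u => phi (upd x a u)).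

Section Closure.
Variables V W : lmodType k.

Lemma multilinear_sum (I : Type) (r : seq I) (P : pred I)
    (F : I -> {ffun 'I_d -> V} -> W) :
  (forall i, multilinear (F i)) ->
  multilinear (fun x => \sum_(i <- r | P i) F i x).
Proof.
move=> h a x c u v; rewrite scaler_sumr -big_split /=.
by apply: eq_bigr => i _; rewrite (h i).
Qed.

Lemma multilinearZ (b : k) (F : {ffun 'I_d -> V} -> W) :
  multilinear F -> multilinear (fun x => b *: F x).
Proof.
by move=> h a x c u v; rewrite (h a x) scalerDr !scalerA [b * c]mulrC.
Qed.

Lemma multilinear_reindex (U : lmodType k) (phi : {ffun 'I_d -> V} -> W)
    (g : 'S_d) (L : 'I_d -> U -> V) :
  (forall a, linear (L a)) -> multilinear phi ->
  multilinear (fun x => phi [ffun a => L a (x (g a))]).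
Proof.
move=> lL h a x c u v; pose b := (g^-1)%g a.
have E w : [ffun s => L s (upd x a w (g s))] = upd [ffun s => L s (x (g s))] b (L b w).
  apply/ffunP=> s; rewrite !ffunE -[s == b](inj_eq (@perm_inj _ g)) permKV.
  by case: eqP => // e; rewrite -[s](permK g) e.
by rewrite !E lL h.
Qed.

Lemma multilinear_comp (U : lmodType k) (phi : {ffun 'I_d -> V} -> W)
    (L : 'I_d -> U -> V) :
  (forall a, linear (L a)) -> multilinear phi ->
  multilinear (fun x => phi [ffun a => L a (x a)]).
Proof.
move=> lL h; have H := multilinear_reindex 1%g lL h => a x c u v.
have := H a x c u v.
have E w : [ffun s => L s (upd x a w ((1%g : 'S_d) s))] = [ffun s => L s (upd x a w s)].
  by apply/ffunP=> s; rewrite !ffunE perm1.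
by rewrite !E.
Qed.

Lemma multilinear_eq0 (phi : {ffun 'I_d -> V} -> W) (x : {ffun 'I_d -> V}) a :
  multilinear phi -> x a = 0 -> phi x = 0.
Proof.
move=> h xa; have E : x = upd x a 0 by apply/ffunP=> b; rewrite ffunE; case: eqP => // ->.
have := h a x 1 0 0; rewrite !scale1r addr0 -E => e.
by apply/esym/(addrI (phi x)); rewrite addr0.
Qed.

End Closure.
End Multilinear.

Definition tpow (k : comPzRingType) (d : nat) (V : lmodType k) : Type :=
  umod (fun W (phi : {ffun 'I_d -> V} -> W) => multilinear phi).
HB.instance Definition _ k d V := GRing.Lmodule.on (@tpow k d V).

Definition tens (k : comPzRingType) (d : nat) (V : lmodType k)
  (x : {ffun 'I_d -> V}) : tpow d V := uin _ x.
Definition tlift (k : comPzRingType) (d : nat) (V W : lmodType k)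
  (phi : {ffun 'I_d -> V} -> W) (t : tpow d V) : W := ulift phi t.

Section TensorTheory.
Variables (k : comPzRingType) (d : nat).

Lemma tlift_tens (V W : lmodType k) (phi : {ffun 'I_d -> V} -> W) x :
  multilinear phi -> tlift phi (tens x) = phi x.
Proof. by move=> h; apply: ulift_uin. Qed.

Lemma tlift_linear (V W : lmodType k) (phi : {ffun 'I_d -> V} -> W) :
  multilinear phi -> linear (tlift phi).
Proof. by move=> h; apply: ulift_linear. Qed.

Lemma tens_multilinear (V : lmodType k) : multilinear (@tens k d V).
Proof.
move=> a x c u v; apply: umodP => W phi h.
by rewrite (ulift_linear h) !(ulift_uin _ h) h.
Qed.

Lemma tens_ext (V W : lmodType k) (f h : tpow d V -> W) :
  linear f -> linear h -> (forall x, f (tens x) = h (tens x)) -> f =1 h.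
Proof. exact: umod_ext. Qed.

Lemma homog_tens_ext (V : supermodType k) (W : lmodType k) (f h : tpow d V -> W) :
  linear f -> linear h ->
  (forall (p : {ffun 'I_d -> bool}) (x : {ffun 'I_d -> V}),
     (forall a, homog (p a) (x a)) -> f (tens x) = h (tens x)) ->
  f =1 h.
Proof.
move=> lf lh fh; apply: tens_ext => // x.
have: forall a, a \notin enum 'I_d -> exists b, homog b (x a).
  by move=> a; rewrite mem_enum.
elim: (enum 'I_d) x => [|a s IH] x hx.
  have /fin_all_exists[p hp] : forall a, exists b, homog b (x a) by move=> a; apply: hx.
  by apply: (fh (finfun p)) => a; rewrite ffunE.
have xE : x = upd x a (1 *: hpart false (x a) + hpart true (x a)).
  by apply/ffunP=> b; rewrite ffunE scale1r hpartD; case: eqP => // ->.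
rewrite xE tens_multilinear lf lh; congr (1 *: _ + _).
  apply: IH => b bs; rewrite ffunE; case: (eqVneq b a) => [_|ba].
    by exists false; apply: homog_hpart.
  by apply: hx; rewrite inE negb_or ba.
apply: IH => b bs; rewrite ffunE; case: (eqVneq b a) => [_|ba].
  by exists true; apply: homog_hpart.
by apply: hx; rewrite inE negb_or ba.
Qed.

(* [u; w] as an element of Z/2 *)
Definition sgn2 (p q : {ffun 'I_d -> bool}) : bool :=
  \big[addb/false]_(u : 'I_d * 'I_d | (u.1 < u.2)%N) (p u.2 && q u.1).

(* the exponent m in the action of g, as an element of Z/2 *)
Definition sgnp (g : 'S_d) (p : {ffun 'I_d -> bool}) : bool :=
  \big[addb/false]_(u : 'I_d * 'I_d |
      (u.1 < u.2)%N && ((g^-1)%g u.2 < (g^-1)%g u.1)%N) (p u.1 && p u.2).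

(* The operation (x_1 ... x_d)(y_1 ... y_d) = +- B(x_1,y_1) ... B(x_d,y_d) with
   the super sign, extended from homogeneous tensors. *)
Definition stbil (U V : supermodType k) (W : lmodType k) (B : U -> V -> W)
    (s : tpow d U) (t : tpow d V) : tpow d W :=
  tlift (fun x => tlift (fun y =>
    \sum_(p : {ffun 'I_d -> bool}) \sum_(q : {ffun 'I_d -> bool})
      (-1) ^+ sgn2 p q *:
        tens [ffun a => B (hpart (p a) (x a)) (hpart (q a) (y a))]) t) s.

(* The right action of g.  The paper composes permutations as functions,
   gh = g \o h, which is [(h * g)%g] in the library. *)
Definition pact (V : supermodType k) (g : 'S_d) (t : tpow d V) : tpow d V :=
  tlift (fun x => \sum_(p : {ffun 'I_d -> bool})
    (-1) ^+ sgnp g p *: tens [ffun a => hpart (p (g a)) (x (g a))]) t.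

Section Bil.
Variables (U V : supermodType k) (W : lmodType k) (B : U -> V -> W).
Hypotheses (Bl : forall y, linear (B^~ y)) (Br : forall x, linear (B x)).

Let core (x : {ffun 'I_d -> U}) (y : {ffun 'I_d -> V}) : tpow d W :=
    \sum_(p : {ffun 'I_d -> bool}) \sum_(q : {ffun 'I_d -> bool})
      (-1) ^+ sgn2 p q *:
        tens [ffun a => B (hpart (p a) (x a)) (hpart (q a) (y a))].

Lemma core_r x : multilinear (core x).
Proof.
apply: multilinear_sum => p; apply: multilinear_sum => q; apply: multilinearZ.
refine (@multilinear_comp _ _ _ _ _ _ (fun a y => B (hpart (p a) (x a)) (hpart (q a) y)) _ _).
  by move=> a c u v; rewrite linearP Br.
exact: tens_multilinear.
Qed.

Lemma core_l y : multilinear (core^~ y).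
Proof.
apply: multilinear_sum => p; apply: multilinear_sum => q; apply: multilinearZ.
refine (@multilinear_comp _ _ _ _ _ _ (fun a x => B (hpart (p a) x) (hpart (q a) (y a))) _ _).
  by move=> a c u v; rewrite linearP Bl.
exact: tens_multilinear.
Qed.

Lemma core_lift t : multilinear (fun x => tlift (core x) t).
Proof.
rewrite /tlift /ulift /fsum.
by apply: multilinear_sum => u; exact/multilinearZ/core_l.
Qed.

Lemma stbil_linl t : linear (fun s => stbil B s t).
Proof. exact/tlift_linear/core_lift. Qed.

Lemma stbil_linr s : linear (stbil B s).
Proof.
move=> c t t'; rewrite /stbil {1 3 5}/tlift /ulift /fsum scaler_sumr -big_split /=.
apply: eq_bigr => u _; rewrite (tlift_linear (core_r u.2)).
by rewrite scalerDr !scalerA [u.1 * c]mulrC.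
Qed.

Lemma stbil_homog (p q : {ffun 'I_d -> bool}) (x : {ffun 'I_d -> U})
    (y : {ffun 'I_d -> V}) :
  (forall a, homog (p a) (x a)) -> (forall a, homog (q a) (y a)) ->
  stbil B (tens x) (tens y) = (-1) ^+ sgn2 p q *: tens [ffun a => B (x a) (y a)].
Proof.
move=> hx hy; rewrite /stbil (tlift_tens _ (core_lift _)) (tlift_tens _ (core_r _)).
have B0l v : B 0 v = 0 by have := Bl v 1 0 0; rewrite !scale1r !addr0 => e; apply/esym/(addrI (B 0 v)); rewrite addr0.
have B0r u : B u 0 = 0 by have := Br u 1 0 0; rewrite !scale1r !addr0 => e; apply/esym/(addrI (B u 0)); rewrite addr0.
rewrite /core (bigD1 p) //= [X in _ + X]big1 => [|p' pp'].
  rewrite addr0 (bigD1 q) //= [X in _ + X]big1 => [|q' qq'].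
    by rewrite addr0; congr (_ *: tens _); apply/ffunP=> a; rewrite !ffunE hx hy.
  suff [a qa] : exists a, q' a != q a.
    rewrite (multilinear_eq0 (a := a)) ?scaler0 //; first exact: tens_multilinear.
    by rewrite ffunE (hpart_homog _ (hy a)) (negbTE qa) B0r.
  apply/existsP; apply: contraNT qq'; rewrite negb_exists => /forallP h.
  by apply/eqP/ffunP=> a; have := h a; rewrite negbK => /eqP.
rewrite big1 // => q' _; suff [a pa] : exists a, p' a != p a.
  rewrite (multilinear_eq0 (a := a)) ?scaler0 //; first exact: tens_multilinear.
  by rewrite ffunE (hpart_homog _ (hx a)) (negbTE pa) B0l.
apply/existsP; apply: contraNT pp'; rewrite negb_exists => /forallP h.
by apply/eqP/ffunP=> a; have := h a; rewrite negbK => /eqP.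
Qed.
End Bil.

Section Perm.
Variable V : supermodType k.

Let core (g : 'S_d) (x : {ffun 'I_d -> V}) : tpow d V :=
  \sum_(p : {ffun 'I_d -> bool})
    (-1) ^+ sgnp g p *: tens [ffun a => hpart (p (g a)) (x (g a))].

Lemma pcore_multilinear g : multilinear (core g).
Proof.
apply: multilinear_sum => p; apply: multilinearZ.
refine (@multilinear_reindex _ _ _ _ _ _ _ (fun a x => hpart (p (g a)) x) _ _).
  by move=> a c u v; rewrite linearP.
exact: tens_multilinear.
Qed.

Lemma pact_linear g : linear (@pact V g).
Proof. exact/tlift_linear/pcore_multilinear. Qed.

Lemma pact_homog g (p : {ffun 'I_d -> bool}) (x : {ffun 'I_d -> V}) :
  (forall a, homog (p a) (x a)) ->
  pact g (tens x) = (-1) ^+ sgnp g p *: tens [ffun a => x (g a)].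
Proof.
move=> hx; rewrite /pact (tlift_tens _ (pcore_multilinear _)).
rewrite /core (bigD1 p) //= [X in _ + X]big1 => [|p' pp'].
  by rewrite addr0; congr (_ *: tens _); apply/ffunP=> a; rewrite !ffunE hx.
suff [a pa] : exists a, p' a != p a.
  rewrite (multilinear_eq0 (a := (g^-1)%g a)) ?scaler0 //.
    exact: tens_multilinear.
  by rewrite ffunE permKV (hpart_homog _ (hx a)) (negbTE pa).
apply/existsP; apply: contraNT pp'; rewrite negb_exists => /forallP h.
by apply/eqP/ffunP=> a; have := h a; rewrite negbK => /eqP.
Qed.
End Perm.
End TensorTheory.

Section SignTheory.
Variable d : nat.
Implicit Types (p q r : {ffun 'I_d -> bool}) (g h : 'S_d).

Lemma sgn2Dl p q r :
  sgn2 [ffun a => p a (+) q a] r = sgn2 p r (+) sgn2 q r.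
Proof.
by rewrite /sgn2 -big_split; apply: eq_bigr => u _; rewrite ffunE andb_addl.
Qed.

Lemma sgn2Dr p q r :
  sgn2 p [ffun a => q a (+) r a] = sgn2 p q (+) sgn2 p r.
Proof.
by rewrite /sgn2 -big_split; apply: eq_bigr => u _; rewrite ffunE andb_addr.
Qed.

Lemma big_addb_cond (I : finType) (P : pred I) (F : I -> bool) :
  \big[addb/false]_(i | P i) F i = \big[addb/false]_i (P i && F i).
Proof. by rewrite big_mkcond; apply: eq_bigr => i _; case: (P i). Qed.

Lemma big_addb_cond4 (I : finType) (P Q S T : pred I) (F G H K : I -> bool) :
  (forall i, (P i && F i) (+) (Q i && G i) = (S i && H i) (+) (T i && K i)) ->
  \big[addb/false]_(i | P i) F i (+) \big[addb/false]_(i | Q i) G i =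
  \big[addb/false]_(i | S i) H i (+) \big[addb/false]_(i | T i) K i.
Proof.
move=> h; rewrite (big_addb_cond P) (big_addb_cond Q) (big_addb_cond S).
by rewrite (big_addb_cond T) -!big_split /=; apply: eq_bigr => i _.
Qed.

Lemma big_addb_cond3 (I : finType) (P Q S : pred I) (F G H : I -> bool) :
  (forall i, (P i && F i) (+) (Q i && G i) = S i && H i) ->
  \big[addb/false]_(i | P i) F i (+) \big[addb/false]_(i | Q i) G i =
  \big[addb/false]_(i | S i) H i.
Proof.
move=> h; rewrite (big_addb_cond P) (big_addb_cond Q) (big_addb_cond S).
by rewrite -big_split /=; apply: eq_bigr => i _.
Qed.

Lemma ord_lt_total (a c : 'I_d) : a != c -> (c < a)%N = ~~ (a < c)%N.
Proof. by rewrite -leqNgt [RHS]leq_eqVlt eq_sym -val_eqE => /negbTE ->. Qed.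

Let swap (u : 'I_d * 'I_d) := (u.2, u.1).
Let swapK : involutive swap. Proof. by case. Qed.

Lemma sgn2_perm g p q :
  sgn2 [ffun a => p (g a)] [ffun a => q (g a)] =
  \big[addb/false]_(u : 'I_d * 'I_d | ((g^-1)%g u.1 < (g^-1)%g u.2)%N)
     (p u.2 && q u.1).
Proof.
pose f (u : 'I_d * 'I_d) := (g u.1, g u.2).
pose f' (u : 'I_d * 'I_d) := ((g^-1)%g u.1, (g^-1)%g u.2).
have fK : cancel f' f by case=> a c; rewrite /f /f' /= !permKV.
have f'K : cancel f f' by case=> a c; rewrite /f /f' /= !permK.
rewrite [RHS](reindex f) /=; last by exists f' => u _.
rewrite /sgn2; apply: eq_big => u; first by rewrite !permK.
by rewrite !ffunE.
Qed.

Lemma sgnp_sgn2 g p q :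
  sgn2 [ffun a => p (g a)] [ffun a => q (g a)] (+)
    sgnp g [ffun a => p a (+) q a] =
  sgn2 p q (+) (sgnp g p (+) sgnp g q).
Proof.
have E : sgnp g [ffun a => p a (+) q a] (+) (sgnp g p (+) sgnp g q) =
  sgn2 p q (+) sgn2 [ffun a => p (g a)] [ffun a => q (g a)].
  rewrite sgn2_perm /sgnp /sgn2 -!big_split /=.
  transitivity (\big[addb/false]_(u : 'I_d * 'I_d |
      (u.1 < u.2)%N && ((g^-1)%g u.2 < (g^-1)%g u.1)%N)
      ((p u.2 && q u.1) (+) (p u.1 && q u.2))).
    apply: eq_bigr => u _; rewrite !ffunE.
    by case: (p u.1); case: (p u.2); case: (q u.1); case: (q u.2).
  rewrite big_split /= [X in _ (+) X](reindex_inj (inv_inj swapK)) /=.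
  apply: big_addb_cond4 => -[a c] /=.
  have [->|ac] := eqVneq a c; first by rewrite !ltnn.
  rewrite (ord_lt_total ac).
  have gac : (g^-1)%g a != (g^-1)%g c by rewrite (inj_eq perm_inj).
  rewrite (ord_lt_total gac).
  by case: (a < c)%N; case: ((g^-1)%g a < (g^-1)%g c)%N; case: (p c); case: (q a).
move: E; move: (sgnp g [ffun _ => _]) (sgn2 [ffun _ => _] _).
by move: (sgn2 p q) (sgnp g p) (sgnp g q); do 5!case.
Qed.

Lemma sgnp_xor g p :
  sgnp g p = \big[addb/false]_(u : 'I_d * 'I_d | (u.1 < u.2)%N)
    (((g^-1)%g u.2 < (g^-1)%g u.1)%N && (p u.1 && p u.2)).
Proof.
rewrite /sgnp big_mkcondr; apply: eq_bigr => u _.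
by case: (_ < _)%N.
Qed.

Lemma sgnpM g h p :
  sgnp g p (+) sgnp h [ffun a => p (g a)] = sgnp (h * g)%g p.
Proof.
have -> : sgnp h [ffun a => p (g a)] =
  \big[addb/false]_(u : 'I_d * 'I_d)
    [&& ((g^-1)%g u.1 < (g^-1)%g u.2)%N,
        ((h * g)^-1%g u.2 < (h * g)^-1%g u.1)%N & p u.1 && p u.2].
  pose f (u : 'I_d * 'I_d) := (g u.1, g u.2).
  pose f' (u : 'I_d * 'I_d) := ((g^-1)%g u.1, (g^-1)%g u.2).
  have fK : cancel f' f by case=> a c; rewrite /f /f' /= !permKV.
  have f'K : cancel f f' by case=> a c; rewrite /f /f' /= !permK.
  rewrite [RHS](reindex f) /=; last by exists f' => u _.
  rewrite /sgnp big_addb_cond; apply: eq_bigr => u _.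
  by rewrite !ffunE invMg !permM !permK !andbA.
pose R (u : 'I_d * 'I_d) := ((g^-1)%g u.1 < (g^-1)%g u.2)%N.
pose R' (u : 'I_d * 'I_d) := ((h * g)^-1%g u.1 < (h * g)^-1%g u.2)%N.
pose w (u : 'I_d * 'I_d) := p u.1 && p u.2.
have tot (s : 'S_d) a c : a != c -> (s c < s a)%N = ~~ (s a < s c)%N.
  by move=> ac; apply: ord_lt_total; rewrite (inj_eq perm_inj).
have -> : \big[addb/false]_(u : 'I_d * 'I_d)
    [&& ((g^-1)%g u.1 < (g^-1)%g u.2)%N,
        ((h * g)^-1%g u.2 < (h * g)^-1%g u.1)%N & p u.1 && p u.2] =
   \big[addb/false]_(u : 'I_d * 'I_d | (u.1 < u.2)%N) ((R u (+) R' u) && w u).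
  rewrite (bigID (fun u : 'I_d * 'I_d => (u.1 < u.2)%N)) /=.
  rewrite [X in _ (+) X](reindex_inj (inv_inj swapK)) /=.
  apply: big_addb_cond3 => -[a c]; rewrite /R /R' /w /=.
  have [->|ac] := eqVneq a c; first by rewrite !ltnn.
  rewrite -(ord_lt_total (a := c)) 1?eq_sym //.
  rewrite !(tot _ _ _ ac).
  by case: (a < c)%N; case: ((g^-1)%g a < _)%N; case: ((h * g)^-1%g a < _)%N;
    case: (p a); case: (p c).
rewrite !sgnp_xor -big_split /=; apply: eq_bigr => -[a c] /= ac.
have ne : a != c by apply: contraL ac => /eqP ->; rewrite ltnn.
rewrite /R /R' /w /= !(tot _ _ _ ne).
by case: ((g^-1)%g a < _)%N; case: ((h * g)^-1%g a < _)%N; case: (p a); case: (p c).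
Qed.

Lemma sgnp1 p : sgnp 1%g p = false.
Proof.
rewrite /sgnp big1 // => -[a c] /=; rewrite invg1 !perm1 => /andP[ac ca].
by have := ltn_trans ac ca; rewrite ltnn.
Qed.

Lemma sgn2_0l p : sgn2 [ffun=> false] p = false.
Proof. by rewrite /sgn2 big1 // => u _; rewrite ffunE. Qed.
Lemma sgn2_0r p : sgn2 p [ffun=> false] = false.
Proof. by rewrite /sgn2 big1 // => u _; rewrite ffunE andbF. Qed.
Lemma sgnp0 g : sgnp g [ffun=> false] = false.
Proof. by rewrite /sgnp big1 // => u _; rewrite !ffunE. Qed.

End SignTheory.

Section TensorAction.
Variables (k : comPzRingType) (d : nat).

Lemma linear_comp (U V W : lmodType k) (f : V -> W) (h : U -> V) :
  linear f -> linear h -> linear (fun x => f (h x)).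
Proof. by move=> lf lh c x y; rewrite lh lf. Qed.

Lemma linearZ_of (V W : lmodType k) (f : V -> W) c x :
  linear f -> f (c *: x) = c *: f x.
Proof.
move=> lf; pose F : {linear V -> W} := HB.pack f (GRing.isLinear.Build _ _ _ _ _ lf).
exact: (linearZ_LR F).
Qed.

Section Assoc.
Variables (U V W X Y Z : supermodType k).
Variables (B1 : U -> V -> X) (B2 : X -> W -> Y) (B3 : V -> W -> Z) (B4 : U -> Z -> Y).
Hypotheses (B1l : forall y, linear (B1^~ y)) (B1r : forall x, linear (B1 x)).
Hypotheses (B2l : forall y, linear (B2^~ y)) (B2r : forall x, linear (B2 x)).
Hypotheses (B3l : forall y, linear (B3^~ y)) (B3r : forall x, linear (B3 x)).
Hypotheses (B4l : forall y, linear (B4^~ y)) (B4r : forall x, linear (B4 x)).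
Hypothesis B1h : forall b c x y, homog b x -> homog c y -> homog (b (+) c) (B1 x y).
Hypothesis B3h : forall b c x y, homog b x -> homog c y -> homog (b (+) c) (B3 x y).
Hypothesis BA : forall x y z, B2 (B1 x y) z = B4 x (B3 y z).

Lemma stbilA (s : tpow d U) (t : tpow d V) (u : tpow d W) :
  stbil B2 (stbil B1 s t) u = stbil B4 s (stbil B3 t u).
Proof.
move: s; apply: homog_tens_ext => [||p x hx].
- exact: (linear_comp (stbil_linl B2l u) (stbil_linl B1l t)).
- exact: (stbil_linl B4l).
move: t; apply: homog_tens_ext => [||q y hy].
- exact: (linear_comp (stbil_linl B2l u) (stbil_linr B1r _)).
- exact: (linear_comp (stbil_linr B4r _) (stbil_linl B3l _)).
move: u; apply: homog_tens_ext => [||r z hz].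
- exact: (stbil_linr B2r).
- exact: (linear_comp (stbil_linr B4r _) (stbil_linr B3r _)).
rewrite (stbil_homog B1l B1r hx hy) (stbil_homog B3l B3r hy hz).
rewrite (linearZ_of _ _ (stbil_linl B2l _)).
rewrite (linearZ_of _ _ (stbil_linr B4r _)).
rewrite (stbil_homog (p := [ffun a => p a (+) q a]) (q := r) B2l B2r) //; last first.
  by move=> a; rewrite !ffunE; apply: B1h.
rewrite (stbil_homog (p := p) (q := [ffun a => q a (+) r a]) B4l B4r) //; last first.
  by move=> a; rewrite !ffunE; apply: B3h.
rewrite !scalerA -!signr_addb; congr (_ ^+ _ *: tens _); last first.
  by apply/ffunP=> a; rewrite !ffunE BA.
rewrite sgn2Dl sgn2Dr.
by case: (sgn2 p q); case: (sgn2 p r); case: (sgn2 q r).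
Qed.
End Assoc.

Section PermBil.
Variables (U V W : supermodType k) (B : U -> V -> W).
Hypotheses (Bl : forall y, linear (B^~ y)) (Br : forall x, linear (B x)).
Hypothesis Bh : forall b c x y, homog b x -> homog c y -> homog (b (+) c) (B x y).

Lemma pact_stbil (g : 'S_d) (s : tpow d U) (t : tpow d V) :
  pact g (stbil B s t) = stbil B (pact g s) (pact g t).
Proof.
move: s; apply: homog_tens_ext => [||p x hx].
- exact: (linear_comp (@pact_linear _ _ _ g) (stbil_linl Bl _)).
- exact: (linear_comp (stbil_linl Bl _) (@pact_linear _ _ _ g)).
move: t; apply: homog_tens_ext => [||q y hy].
- exact: (linear_comp (@pact_linear _ _ _ g) (stbil_linr Br _)).
- exact: (linear_comp (stbil_linr Br _) (@pact_linear _ _ _ g)).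
rewrite (stbil_homog Bl Br hx hy) (pact_homog _ hx) (pact_homog _ hy).
rewrite (linearZ_of _ _ (@pact_linear _ _ _ g)).
rewrite (linearZ_of _ _ (stbil_linl Bl _)).
rewrite (linearZ_of _ _ (stbil_linr Br _)).
rewrite (@pact_homog _ _ _ _ [ffun a => p a (+) q a]); last first.
  by move=> a; rewrite !ffunE; apply: Bh.
rewrite (stbil_homog (p := [ffun a => p (g a)]) (q := [ffun a => q (g a)]) Bl Br);
  [|by move=> a; rewrite !ffunE..].
rewrite !scalerA -!signr_addb; congr (_ ^+ _ *: tens _); last first.
  by apply/ffunP=> a; rewrite !ffunE.
have := sgnp_sgn2 g p q.
by case: (sgn2 p q); case: (sgnp g p); case: (sgnp g q);
  case: (sgn2 _ _); case: (sgnp _ _).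
Qed.
End PermBil.

Section PermAction.
Variable V : supermodType k.
Implicit Types (t : tpow d V) (g h : 'S_d).

Lemma pactM g h t : pact h (pact g t) = pact (h * g)%g t.
Proof.
move: t; apply: homog_tens_ext => [||p x hx].
- exact: (linear_comp (@pact_linear _ _ _ h) (@pact_linear _ _ _ g)).
- exact: pact_linear.
rewrite !(pact_homog _ hx) (linearZ_of _ _ (@pact_linear _ _ _ h)).
rewrite (@pact_homog _ _ _ _ [ffun a => p (g a)]); last by move=> a; rewrite !ffunE.
rewrite scalerA -signr_addb sgnpM; congr (_ *: tens _).
by apply/ffunP=> a; rewrite !ffunE permM.
Qed.

Lemma pact1 t : pact 1%g t = t.
Proof.
move: t; apply: homog_tens_ext => [||p x hx]; first exact: pact_linear.
  by move=> c x y.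
rewrite (pact_homog _ hx) sgnp1 scale1r; congr tens.
by apply/ffunP=> a; rewrite !ffunE perm1.
Qed.
End PermAction.
End TensorAction.

Section TensorAlgebra.
Variables (k : comPzRingType) (d : nat) (A : superalg k).

Definition talg : Type := tpow d A.
HB.instance Definition _ := GRing.Lmodule.copy talg (tpow d A).

Lemma saMl (y : A) : linear (fun x : A => x * y).
Proof. by move=> c u v; rewrite mulrDl sascaleAl. Qed.
Lemma saMr (x : A) : linear (fun y : A => x * y).
Proof. by move=> c u v; rewrite mulrDr sascaleAr. Qed.

Definition tmul (s t : talg) : talg := stbil (fun x y : A => x * y) s t.
Definition tone : talg := tens ([ffun=> 1] : {ffun 'I_d -> A}).

Fact tmulA : associative tmul.
Proof.
move=> s t u; apply/esym/stbilA; try exact: saMl; try exact: saMr.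
- exact: homogM.
- exact: homogM.
- by move=> x y z; rewrite mulrA.
Qed.

Let homog1' (a : 'I_d) :
  homog ([ffun=> false] a : bool) (([ffun=> 1] : {ffun 'I_d -> A}) a).
Proof. by rewrite !ffunE; apply: homog1. Qed.

Fact tmul1 : left_id tone tmul.
Proof.
apply: homog_tens_ext => [||p x hx]; first exact: (stbil_linr saMr).
  by move=> c u v.
rewrite /tmul (stbil_homog saMl saMr homog1' hx) sgn2_0l scale1r.
by congr tens; apply/ffunP=> a; rewrite !ffunE mul1r.
Qed.

Fact tmulr1 : right_id tone tmul.
Proof.
apply: homog_tens_ext => [||p x hx]; first exact: (stbil_linl saMl).
  by move=> c u v.
rewrite /tmul (stbil_homog saMl saMr hx homog1') sgn2_0r scale1r.
by congr tens; apply/ffunP=> a; rewrite !ffunE mulr1.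
Qed.

Fact tmulDl : left_distributive tmul +%R.
Proof. by move=> s t u; have := stbil_linl saMl u 1 s t; rewrite !scale1r. Qed.
Fact tmulDr : right_distributive tmul +%R.
Proof. by move=> s t u; have := stbil_linr saMr s 1 t u; rewrite !scale1r. Qed.
HB.instance Definition _ :=
  GRing.Zmodule_isPzRing.Build talg tmulA tmul1 tmulr1 tmulDl tmulDr.

Lemma talgZl (c : k) (s t : talg) : c *: (s * t) = (c *: s) * t.
Proof. by apply/esym/(linearZ_of _ _ (stbil_linl saMl t)). Qed.
Lemma talgZr (c : k) (s t : talg) : c *: (s * t) = s * (c *: t).
Proof. by apply/esym/(linearZ_of _ _ (stbil_linr saMr s)). Qed.

Lemma pact_mul (g : 'S_d) (s t : talg) : pact g (s * t) = (pact g s : talg) * pact g t.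
Proof. by apply: (pact_stbil saMl saMr); exact: homogM. Qed.
Lemma pact_one (g : 'S_d) : pact g (1 : talg) = (1 : talg).
Proof.
rewrite (pact_homog g homog1') sgnp0 scale1r; congr tens.
by apply/ffunP=> a; rewrite !ffunE.
Qed.

(* x[t] *)
Definition at_pos (x : A) (t : 'I_d) : talg :=
  tens [ffun a => if a == t then x else 1].

End TensorAlgebra.

(* The function f stands for the sum over g of f(g) (x) g in
   A^(tensor d) (x) kS_d. *)
Definition wreath (k : comPzRingType) (d : nat) (A : superalg k) : Type :=
  {ffun 'S_d -> talg d A}.

Section Wreath.
Variables (k : comPzRingType) (d : nat) (A : superalg k).
Local Notation W := (wreath d A).
HB.instance Definition _ := GRing.Lmodule.copy W {ffun 'S_d -> talg d A}.

Definition wtens (x : talg d A) (g : 'S_d) : W :=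
  [ffun h => if h == g then x else 0].

(* (x (x) g)(y (x) h) = x y^(g^-1) (x) gh: the paper's g^-1 h is the library's
   [(h * g^-1)%g]. *)
Definition wmul (u v : W) : W :=
  [ffun h => \sum_g u g * pact (g^-1)%g (v (h * g^-1)%g)].
Definition wone : W := wtens 1 1%g.

Let pactD g (s t : talg d A) : pact g (s + t) = (pact g s : talg d A) + pact g t.
Proof. by have := @pact_linear _ _ _ g 1 s t; rewrite !scale1r. Qed.
Let pact0 g : pact g (0 : talg d A) = 0.
Proof. by apply: (addrI (pact g (0 : talg d A))); rewrite -pactD !addr0. Qed.
Let pact_sum g (I : finType) (F : I -> talg d A) :
  pact g (\sum_i F i) = \sum_i (pact g (F i) : talg d A).
Proof. by elim/big_rec2: _ => [|i x y _ <-]; rewrite ?pact0 ?pactD. Qed.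

Fact wmulA : associative wmul.
Proof.
move=> u v w; apply/ffunP=> h; rewrite !ffunE.
under eq_bigr => g _ do rewrite ffunE pact_sum mulr_sumr.
under [RHS]eq_bigr => m _ do rewrite ffunE mulr_suml.
rewrite [RHS]exchange_big; apply: eq_bigr => g _ /=.
rewrite [RHS](reindex_inj (mulIg g)) /=; apply: eq_bigr => m _.
rewrite pact_mul pactM mulrA mulgK invMg mulgA; congr (_ * _).
Qed.

Fact wmul1 : left_id wone wmul.
Proof.
move=> u; apply/ffunP=> h; rewrite ffunE (bigD1 1%g) //= big1 => [|g g1].
  by rewrite ffunE eqxx addr0 mul1r invg1 mulg1 pact1.
by rewrite ffunE (negbTE g1) mul0r.
Qed.

Fact wmulr1 : right_id wone wmul.
Proof.
move=> u; apply/ffunP=> h; rewrite ffunE (bigD1 h) //= big1 => [|g g1].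
  by rewrite ffunE mulgV eqxx addr0 pact_one mulr1.
rewrite ffunE; case: eqP => [e|_]; last by rewrite pact0 mulr0.
by case/eqP: g1; rewrite -[h](mulgKV g) e mul1g.
Qed.

Fact wmulDl : left_distributive wmul +%R.
Proof.
move=> u v w; apply/ffunP=> h; rewrite !ffunE -big_split /=.
by apply: eq_bigr => g _; rewrite ffunE mulrDl.
Qed.
Fact wmulDr : right_distributive wmul +%R.
Proof.
move=> u v w; apply/ffunP=> h; rewrite !ffunE -big_split /=.
by apply: eq_bigr => g _; rewrite ffunE pactD mulrDr.
Qed.
HB.instance Definition _ :=
  GRing.Zmodule_isPzRing.Build W wmulA wmul1 wmulr1 wmulDl wmulDr.

Lemma wreathZl (c : k) (u v : W) : c *: (u * v) = (c *: u) * v.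
Proof.
apply/ffunP=> h; rewrite !ffunE scaler_sumr; apply: eq_bigr => g _.
by rewrite ffunE talgZl.
Qed.
Lemma wreathZr (c : k) (u v : W) : c *: (u * v) = u * (c *: v).
Proof.
apply/ffunP=> h; rewrite !ffunE scaler_sumr; apply: eq_bigr => g _.
by rewrite ffunE (linearZ_of _ _ (@pact_linear _ _ _ _)) talgZr.
Qed.

Lemma wtensM (x y : talg d A) (g h : 'S_d) :
  wtens x g * wtens y h = wtens (x * pact (g^-1)%g y) (h * g)%g.
Proof.
apply/ffunP=> m; rewrite !ffunE (bigD1 g) //= big1 => [|g' g'g].
  rewrite !ffunE eqxx addr0 (canF_eq (mulgKV g)).
  by case: eqP => // _; rewrite pact0 mulr0.
by rewrite ffunE (negbTE g'g) mul0r.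
Qed.

End Wreath.

Section Schur.
Variables (k : comPzRingType) (A : superalg k) (n d : nat).
Local Notation T := (talg d (Msuper A n)).

Definition invariant : pred T := fun x => [forall g : 'S_d, pact g x == x].

Fact invariant_submod : submod_closed invariant.
Proof.
split=> [|c x y /forallP hx /forallP hy].
  apply/forallP=> g; apply/eqP.
  by have := linearZ_of 0 (0 : T) (@pact_linear _ _ _ g); rewrite !scale0r.
by apply/forallP=> g; rewrite pact_linear (eqP (hx g)) (eqP (hy g)).
Qed.
Fact invariant_subring : subring_closed invariant.
Proof.
split=> [|x y hx hy|x y /forallP hx /forallP hy].
- by apply/forallP=> g; rewrite pact_one.
- by have [_ h] := invariant_submod; rewrite addrC -scaleN1r; apply: h.
- by apply/forallP=> g; rewrite pact_mul (eqP (hx g)) (eqP (hy g)).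
Qed.
HB.instance Definition _ := GRing.isSubringClosed.Build T invariant invariant_subring.
Fact invariant_scale : forall c : k, {in invariant, forall x, c *: x \in invariant}.
Proof.
by move=> c x hx; have [h0 h] := invariant_submod; rewrite -[_ *: _]addr0; apply: h.
Qed.
HB.instance Definition _ := GRing.isScaleClosed.Build k T invariant invariant_scale.

(* S^A(n, d) *)
Record schur : Type := Schur { schur_val :> T; _ : invariant schur_val }.
HB.instance Definition _ := [isSub for schur_val].
HB.instance Definition _ := [Choice of schur by <:].
HB.instance Definition _ :=
  GRing.SubChoice_isSubPzRing.Build _ _ schur (GRing.subringClosedP _).
HB.instance Definition _ := [SubZmodule_isSubLmodule of schur by <:].

End Schur.

(* Right W_d^A-modules, as k-modules with a k-bilinear right action, and their
   endomorphism algebras. *)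
Record wmodule (k : comPzRingType) (d : nat) (A : superalg k) := WModule {
  wm_mod :> lmodType k;
  wm_act : wm_mod -> wreath d A -> wm_mod;
  wm_actl : forall w, linear (wm_act^~ w);
  wm_actr : forall m, linear (wm_act m);
  wm_act1 : forall m, wm_act m 1 = m;
  wm_actM : forall m v w, wm_act m (v * w) = wm_act (wm_act m v) w
}.

Section Endomorphisms.
Variables (k : comPzRingType) (d : nat) (A : superalg k) (M : wmodule d A).

Record wend : Type := WEnd {
  wend_fun :> M -> M;
  wend_linear : linear wend_fun;
  wend_act : forall m w, wend_fun (wm_act m w) = wm_act (wend_fun m) w
}.

Lemma wendP (f g : wend) : f =1 g -> f = g.
Proof.
case: f g => [f lf af] [g lg ag] /= /funext fg; subst g.
by congr WEnd; apply: Prop_irrelevance.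
Qed.

HB.instance Definition _ := gen_eqMixin wend.
HB.instance Definition _ := gen_choiceMixin wend.

Let act0 w : wm_act (0 : M) w = 0.
Proof. by have := linearZ_of 0 0 (@wm_actl _ _ _ M w); rewrite !scale0r. Qed.
Let actD (x y : M) w : wm_act (x + y) w = wm_act x w + wm_act y w.
Proof. by have := wm_actl w 1 x y; rewrite !scale1r. Qed.
Let actZ c (x : M) w : wm_act (c *: x) w = c *: wm_act x w.
Proof. exact: (linearZ_of _ _ (@wm_actl _ _ _ M w)). Qed.
Let endD (f : wend) x y : f (x + y) = f x + f y.
Proof. by have := wend_linear f 1 x y; rewrite !scale1r. Qed.

Definition wend0 : wend.
Proof.
by refine (@WEnd (fun=> 0) _ _) => [c x y|m w]; rewrite ?scaler0 ?addr0 ?act0.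
Defined.
Definition wend_add (f g : wend) : wend.
Proof.
refine (@WEnd (fun m => f m + g m) _ _) => [c x y|m w].
  by rewrite !wend_linear scalerDr addrACA.
by rewrite !wend_act actD.
Defined.
Definition wend_scale (c : k) (f : wend) : wend.
Proof.
refine (@WEnd (fun m => c *: f m) _ _) => [b x y|m w].
  by rewrite wend_linear scalerDr !scalerA [c * b]mulrC.
by rewrite wend_act actZ.
Defined.
Definition wend1 : wend.
Proof. by refine (@WEnd (fun m => m) _ _). Defined.
Definition wend_mul (f g : wend) : wend.
Proof.
refine (@WEnd (fun m => f (g m)) _ _) => [c x y|m w].
  by rewrite !wend_linear.
by rewrite !wend_act.
Defined.

Fact wend_addA : associative wend_add.
Proof. by move=> f g h; apply: wendP => m /=; rewrite addrA. Qed.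
Fact wend_addC : commutative wend_add.
Proof. by move=> f g; apply: wendP => m /=; rewrite addrC. Qed.
Fact wend_add0 : left_id wend0 wend_add.
Proof. by move=> f; apply: wendP => m /=; rewrite add0r. Qed.
Fact wend_addN : left_inverse wend0 (wend_scale (-1)) wend_add.
Proof. by move=> f; apply: wendP => m /=; rewrite scaleN1r addNr. Qed.
HB.instance Definition _ :=
  GRing.isZmodule.Build wend wend_addA wend_addC wend_add0 wend_addN.

Fact wend_mulA : associative wend_mul. Proof. by move=> f g h; apply: wendP. Qed.
Fact wend_mul1 : left_id wend1 wend_mul. Proof. by move=> f; apply: wendP. Qed.
Fact wend_mulr1 : right_id wend1 wend_mul. Proof. by move=> f; apply: wendP. Qed.
Fact wend_mulDl : left_distributive wend_mul +%R.
Proof. by move=> f g h; apply: wendP. Qed.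
Fact wend_mulDr : right_distributive wend_mul +%R.
Proof. by move=> f g h; apply: wendP => m /=; rewrite endD. Qed.
HB.instance Definition _ := GRing.Zmodule_isPzRing.Build wend
  wend_mulA wend_mul1 wend_mulr1 wend_mulDl wend_mulDr.

Fact wend_scaleA a b f : wend_scale a (wend_scale b f) = wend_scale (a * b) f.
Proof. by apply: wendP => m /=; rewrite scalerA. Qed.
Fact wend_scale1 : left_id 1 wend_scale.
Proof. by move=> f; apply: wendP => m /=; rewrite scale1r. Qed.
Fact wend_scaleDr : right_distributive wend_scale +%R.
Proof. by move=> a f g; apply: wendP => m /=; rewrite scalerDr. Qed.
Fact wend_scaleDl f : {morph wend_scale^~ f : a b / a + b}.
Proof. by move=> a b; apply: wendP => m /=; rewrite scalerDl. Qed.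
HB.instance Definition _ := GRing.Zmodule_isLmodule.Build k wend
  wend_scaleA wend_scale1 wend_scaleDr wend_scaleDl.

End Endomorphisms.

Section DirectSum.
Variables (k : comPzRingType) (d : nat) (A : superalg k) (I : finType).
Variable F : I -> wmodule d A.

Definition dsum_type : Type := forall i, F i.
HB.instance Definition _ := Choice.copy dsum_type (forall i, F i).

Let zero : dsum_type := fun i => 0.
Let add (x y : dsum_type) : dsum_type := fun i => x i + y i.
Let opp (x : dsum_type) : dsum_type := fun i => - x i.
Fact dsum_addA : associative add.
Proof. by move=> x y z; apply: functional_extensionality_dep => i; apply: addrA. Qed.
Fact dsum_addC : commutative add.
Proof. by move=> x y; apply: functional_extensionality_dep => i; apply: addrC. Qed.
Fact dsum_add0 : left_id zero add.
Proof. by move=> x; apply: functional_extensionality_dep => i; apply: add0r. Qed.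
Fact dsum_addN : left_inverse zero opp add.
Proof. by move=> x; apply: functional_extensionality_dep => i; apply: addNr. Qed.
HB.instance Definition _ :=
  GRing.isZmodule.Build dsum_type dsum_addA dsum_addC dsum_add0 dsum_addN.

Let scale (c : k) (x : dsum_type) : dsum_type := fun i => c *: x i.
Fact dsum_scaleA a b x : scale a (scale b x) = scale (a * b) x.
Proof. by apply: functional_extensionality_dep => i; apply: scalerA. Qed.
Fact dsum_scale1 : left_id 1 scale.
Proof. by move=> x; apply: functional_extensionality_dep => i; apply: scale1r. Qed.
Fact dsum_scaleDr : right_distributive scale +%R.
Proof. by move=> a x y; apply: functional_extensionality_dep => i; apply: scalerDr. Qed.
Fact dsum_scaleDl x : {morph scale^~ x : a b / a + b}.
Proof. by move=> a b; apply: functional_extensionality_dep => i; apply: scalerDl. Qed.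
HB.instance Definition _ := GRing.Zmodule_isLmodule.Build k dsum_type
  dsum_scaleA dsum_scale1 dsum_scaleDr dsum_scaleDl.

Definition dsum : wmodule d A.
Proof.
refine (@WModule k d A dsum_type (fun x w i => wm_act (x i) w) _ _ _ _).
- by move=> w c x y; apply: functional_extensionality_dep => i; apply: wm_actl.
- by move=> m c v w; apply: functional_extensionality_dep => i; apply: wm_actr.
- by move=> m; apply: functional_extensionality_dep => i; apply: wm_act1.
- by move=> m v w; apply: functional_extensionality_dep => i; apply: wm_actM.
Defined.

End DirectSum.

(* Colored compositions: the parts are at most d, hence the type 'I_d.+1. *)
Section Compositions.
Variables (n l d : nat).

Definition ccomp : finType :=
  {lam : {ffun 'I_n * 'I_l -> 'I_d.+1} | \sum_x (lam x : nat) == d}.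

Definition color_seq (lam : ccomp) : seq ('I_n * 'I_l) :=
  flatten [seq nseq (val lam x) x
          | x <- [seq (r, i) | r <- enum 'I_n, i <- enum 'I_l]].

Fact size_color_seq lam : size (color_seq lam) == d.
Proof.
case: lam => lam /= h; rewrite -[X in _ == X](eqP h) /color_seq /=.
rewrite size_flatten sumnE /shape -map_comp big_map big_allpairs_dep /=.
apply/eqP; rewrite big_enum /=.
under eq_bigr => r _ do rewrite big_enum.
rewrite pair_big; apply: eq_bigr => x _ /=.
by rewrite size_nseq -surjective_pairing.
Qed.

(* [tnth (color lam) a] is the pair (r, i) whose segment contains a. *)
Definition color (lam : ccomp) : d.-tuple ('I_n * 'I_l) := Tuple (size_color_seq lam).

Definition segment (lam : ccomp) (x : 'I_n * 'I_l) : {set 'I_d} :=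
  [set a | tnth (color lam) a == x].

Definition in_young (lam : ccomp) (g : 'S_d) : bool :=
  [forall a, tnth (color lam) (g a) == tnth (color lam) a].

Definition perm_length (g : 'S_d) : nat :=
  #|[set u : 'I_d * 'I_d | (u.1 < u.2)%N && (g u.2 < g u.1)%N]|.

(* The component of g on a segment is seen as a permutation of [1, d], which
   does not change its length. *)
Definition young_sign (k : comPzRingType) (par : 'I_l -> bool) (lam : ccomp)
    (g : 'S_d) : k :=
  \prod_(x : 'I_n * 'I_l)
    (if par x.2 then -1 else 1) ^+ perm_length (restr_perm (segment lam x) g).

End Compositions.

Section PermutationModule.
Variables (k : comPzRingType) (A : superalg k) (l n d : nat).
Variables (par : 'I_l -> bool) (e : 'I_l -> A).
Local Notation W := (wreath d (ungraded A)).
Variable lam : ccomp n l d.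

Definition e_lam : talg d (ungraded A) :=
  tens ([ffun a => e (tnth (color lam) a).2] : {ffun 'I_d -> ungraded A}).

(* e_lambda W_d^|A| *)
Definition in_eW : pred W := fun w => `[< exists u : W, w = wtens e_lam 1%g * u >].

Fact in_eW_submod : submod_closed in_eW.
Proof.
split=> [|c x y /asboolP[u ->] /asboolP[v ->]]; apply/asboolP.
  by exists 0; rewrite mulr0.
by exists (c *: u + v); rewrite mulrDr wreathZr.
Qed.
HB.instance Definition _ := GRing.isSubmodClosed.Build k W in_eW in_eW_submod.
Record eW : Type := EW { eW_val :> W; eW_prop : in_eW eW_val }.
HB.instance Definition _ := [isSub for eW_val].
HB.instance Definition _ := [Choice of eW by <:].
HB.instance Definition _ := [SubChoice_isSubLmodule of eW by <:].

Fact eW_gen_subproof : in_eW (wtens e_lam 1%g).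
Proof. by apply/asboolP; exists 1; rewrite mulr1. Qed.
Definition eW_gen : eW := EW eW_gen_subproof.

Fact eW_left_subproof (g : 'S_d) (x : eW) : in_eW (wtens e_lam g * eW_val x).
Proof.
apply/asboolP; exists (wtens 1 g * eW_val x); rewrite mulrA wtensM.
by rewrite invg1 pact1 mulr1 mulg1.
Qed.
Definition eW_left (g : 'S_d) (x : eW) : eW := EW (eW_left_subproof g x).

Fact eW_right_subproof (x : eW) (w : W) : in_eW (eW_val x * w).
Proof.
case: x => x /= /asboolP[u ->]; apply/asboolP; exists (u * w).
by rewrite mulrA.
Qed.
Definition eW_right (x : eW) (w : W) : eW := EW (eW_right_subproof x w).

(* alt_lambda is k with (e_lambda (x) g) acting by the sign of g; its tensor
   product with e_lambda W_d^|A| over W_lambda^|A| is the target of the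
   universal balanced map.  The elements e_lambda (x) g span W_lambda^|A|. *)
Definition balanced (V : lmodType k) (phi : k * eW -> V) : Prop :=
  [/\ forall x : eW, linear (fun c : k^o => phi (c, x)),
      forall c : k, linear (fun x : eW => phi (c, x))
    & forall g : 'S_d, in_young lam g -> forall (c : k) (x : eW),
        phi (c * young_sign k par lam g, x) = phi (c, eW_left g x)].

Definition pmod_type : Type := umod balanced.
HB.instance Definition _ := GRing.Lmodule.on pmod_type.

Definition pmod_tens (c : k) (x : eW) : pmod_type := uin balanced (c, x).
Definition pmod_act (m : pmod_type) (w : W) : pmod_type :=
  ulift (fun u : k * eW => pmod_tens u.1 (eW_right u.2 w)) m.

Lemma pmod_tens_balanced : balanced (fun u => pmod_tens u.1 u.2).
Proof.
split=> [x c u v|c b x y|g hg c x]; apply: umodP => V phi gphi /=;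
  rewrite ?(ulift_linear gphi) !(ulift_uin _ gphi); case: gphi => h1 h2 h3.
- exact: h1.
- exact: h2.
- exact: h3.
Qed.

Lemma pmod_act_balanced w :
  balanced (fun u : k * eW => pmod_tens u.1 (eW_right u.2 w)).
Proof.
have [h1 h2 h3] := pmod_tens_balanced.
split=> [x c u v|c b x y|g hg c x] /=; first exact: h1.
  rewrite -[RHS]h2; congr pmod_tens; apply: val_inj => /=.
  by rewrite mulrDl wreathZl.
rewrite [LHS]h3 //; congr pmod_tens; apply: val_inj => /=.
by rewrite mulrA.
Qed.

Lemma pmod_act_tens c x w : pmod_act (pmod_tens c x) w = pmod_tens c (eW_right x w).
Proof. by rewrite /pmod_act (ulift_uin _ (pmod_act_balanced w)). Qed.

Lemma pmod_actl w : linear (pmod_act^~ w).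
Proof. exact/ulift_linear/pmod_act_balanced. Qed.

Lemma pmod_ext (V : lmodType k) (f h : pmod_type -> V) : linear f -> linear h ->
  (forall c x, f (pmod_tens c x) = h (pmod_tens c x)) -> f =1 h.
Proof. by move=> lf lh fh; apply: umod_ext => // -[c x]; apply: fh. Qed.

(* M_lambda^|A| *)
Definition pmod : wmodule d (ungraded A).
Proof.
refine (@WModule k d (ungraded A) pmod_type pmod_act pmod_actl _ _ _).
- move=> m c v w; move: m; apply: pmod_ext => [|b x y|b x].
  + exact: pmod_actl.
  + by rewrite !pmod_actl !scalerDr addrACA !scalerA [c * b]mulrC.
  rewrite !pmod_act_tens; have [_ h2 _] := pmod_tens_balanced.
  rewrite -[RHS]h2; congr pmod_tens; apply: val_inj => /=.
  by rewrite mulrDr wreathZr.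
- apply: pmod_ext => [||c x]; [exact: pmod_actl|by []|].
  by rewrite pmod_act_tens; congr pmod_tens; apply: val_inj; rewrite /= mulr1.
- move=> m v w; move: m; apply: pmod_ext => [||c x]; first exact: pmod_actl.
    exact: (linear_comp (pmod_actl w) (pmod_actl v)).
  by rewrite !pmod_act_tens; congr pmod_tens; apply: val_inj; rewrite /= mulrA.
Defined.

Definition pmod_gen : pmod := pmod_tens 1 eW_gen.

End PermutationModule.

Section Psi.
Variables (k : comPzRingType) (A : superalg k) (l n d : nat).
Variables (par : 'I_l -> bool) (e : 'I_l -> A) (eps : bool -> A).
Local Notation W := (wreath d A).
Local Notation W' := (wreath d (ungraded A)).
Local Notation V := (smx A n 1).
Local Notation Lambda := (ccomp n l d).

(* M^|A|(n, d) *)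
Definition Mnd : wmodule d (ungraded A) := dsum (fun lam : Lambda => pmod par e lam).
Definition m_lam (lam : Lambda) : Mnd :=
  fun mu => if mu == lam then pmod_gen par e mu else 0.

Definition v_lam (lam : Lambda) : tpow d V :=
  tens [ffun a => (\matrix_(s, _)
    if s == (tnth (color lam) a).1 then e (tnth (color lam) a).2 else 0) : V].

Definition left_act (y : talg d (Msuper A n)) (v : tpow d V) : tpow d V :=
  stbil (fun (x : Msuper A n) (u : V) => smul x u : V) y v.
Definition right_act (v : tpow d V) (w : W) : tpow d V :=
  \sum_g pact g (stbil (fun (u : V) (a : A) => scalr u a) v (w g)).

Definition winc (B : superalg k) (x : talg d B) : wreath d B := wtens x 1%g.

(* the image of x[t], for x of parity b; the positions before t, counted from 0,
   carry the idempotents *)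
Definition sigma_at (x : A) (b : bool) (t : 'I_d) : talg d A :=
  \sum_(s : {ffun 'I_t -> bool}) (-1) ^+ ((\big[addb/false]_j s j) && b) *:
    tens ([ffun a : 'I_d =>
             if insub (a : nat) is Some j then eps (s j)
             else if a == t then x else 1] : {ffun 'I_d -> A}).

Definition eps2 (b c : bool) (r r' : 'I_d) : W :=
  winc (at_pos (eps b) r * at_pos (eps c) r').

Definition is_sigma (sigma : W' -> W) : Prop :=
  [/\ is_alg_iso sigma,
      forall (t : 'I_d) (b : bool) (x : A), homog b x ->
        sigma (winc (at_pos (x : ungraded A) t)) = winc (sigma_at x b t)
    & forall r r' : 'I_d, r' = r.+1 :> nat ->
        sigma (wtens 1 (tperm r r')) =
          wtens 1 (tperm r r') *
            (eps2 false false r r' + eps2 false true r r'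
             + eps2 true false r r' - eps2 true true r r')].

(* [sigma'] is the inverse of [sigma] *)
Definition is_psi (sigma' : W -> W') (psi : schur A n d -> wend Mnd) : Prop :=
  forall (y : schur A n d) (lam : Lambda) (h : Lambda -> W),
    left_act y (v_lam lam) = \sum_mu right_act (v_lam mu) (h mu) ->
    psi y (m_lam lam) = \sum_mu wm_act (m_lam mu) (sigma' (h mu)).

Definition is_basis (B : superalg k) (P : B -> Prop) (m : nat) (b : 'I_m -> B) :=
  (forall j, P (b j)) /\
  forall x, P x -> exists! c : {ffun 'I_m -> k}, x = \sum_j c j *: b j.

Definition free_of_finite_rank (B : superalg k) :=
  exists m (b : 'I_m -> B), is_basis (fun=> True) b.

Definition has_homog_basis (B : superalg k) (P : B -> Prop) :=
  exists m (b : 'I_m -> B), is_basis P b /\ forall j, exists c, homog c (b j).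

(* The sums e^0 A e^0 + e^1 A e^1 and e^0 A e^1 + e^1 A e^0 are direct by
   orthogonality. *)
Definition adapted_pair : Prop :=
  [/\ forall b c, eps b * eps c = if b == c then eps b else 0,
      1 = eps false + eps true
    & forall b (x : A), homog b x <->
        exists u v : A,
          x = eps false * u * eps b + eps true * v * eps (~~ b)].

End Psi.

(* Main.v *)
Require Import Defs.
From mathcomp Require Import all_boot perm all_algebra.
From mathcomp Require Import fingroup action generic_quotient boolp zify.

Set Implicit Arguments.
Unset Strict Implicit.
Unset Printing Implicit Defensive.

Import GRing.Theory.
Local Open Scope ring_scope.

(** Write V = A^n and W = W_d^A.  Both sides are identified with the
    algebra of W-endomorphisms of the tensor space V^(tensor d).

    The grading of A is inner, since gamma = e^0 - e^1 satisfies
    gamma x gamma^-1 = (-1)^|x| x; so the super signs can be absorbed by powers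
    of gamma.  On a tensor of elements x_a of the corners e^(al_a) A e^(be_a),
    sigma is multiplication by the sign (-1)^[al + be; be], and
    sigma(g) = D_g g, where D_g is the sum over ga in (Z/2)^d of the idempotents
    e^ga, each with the sign by which g permutes odd factors in the places
    where ga is odd.  Multiplicativity of sigma reduces to cocycle identities
    for these signs (twistM, perm_signM, perm_sign_pact), and bijectivity is
    clear, as all the signs are their own inverses.  It is unique because the
    x[t] with x homogeneous and the adjacent transpositions generate W_d^|A|
    (is_sigma_inj).

    Every endomorphism of V^(tensor d) commuting with W comes from a unique
    element of S^A(n, d): V^(tensor d) is free over A^(tensor d) on the tensors
    of standard columns, so that an element of M_n(A)^(tensor d) is its matrix
    of coefficients in A^(tensor d), and commuting with the symmetric group
    means being invariant under it (emxten_coef, right_linear_left_act).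

    On the other side, m_la w |-> v_la sigma(w) is a well defined W-linear map
    from M^|A|(n, d) to V^(tensor d), because sigma sends e_la (x) g to
    eps_la(g) e_la (x) g for g in the Young subgroup of la (sigma_map_e_lam):
    the sign in D_g counts the inversions of g inside the segments of odd
    colour (young_sign_sgnp).  It is bijective: V^(tensor d) is the direct sum,
    over all colourings c of the d places by pairs (r, i), of the spaces
    v_c A^(tensor d), and each c is a permutation of the colouring of exactly
    one composition (color_perm_ex, color_perm_inj), which gives the inverse.
    Transporting the left action of S^A(n, d) along this bijection is psi. *)

(** * Linear and multilinear maps *)

Lemma ffun_neqP (I : finType) (T : eqType) (f g : {ffun I -> T}) :
  f != g -> exists a, f a != g a.
Proof.
move=> ne; apply/existsP; apply: contraNT ne; rewrite negb_exists => /forallP h.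
by apply/eqP/ffunP=> a; have := h a; rewrite negbK => /eqP.
Qed.

Section LinearMaps.
Variables (k : comPzRingType) (V W : lmodType k) (f : V -> W).
Hypothesis lf : linear f.

Lemma lin0 : f 0 = 0.
Proof. by have := linearZ_of 0 0 lf; rewrite !scale0r. Qed.

Lemma linD x y : f (x + y) = f x + f y.
Proof. by have := lf 1 x y; rewrite !scale1r. Qed.

Lemma lin_sum (I : Type) (r : seq I) (P : pred I) (F : I -> V) :
  f (\sum_(i <- r | P i) F i) = \sum_(i <- r | P i) f (F i).
Proof. exact: (big_morph f linD lin0). Qed.
End LinearMaps.

Section MultilinearExpansion.
Variables (k : comPzRingType) (d : nat).

Section OneMap.
Variables (V W : lmodType k) (phi : {ffun 'I_d -> V} -> W).
Hypothesis phiM : multilinear phi.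

(** The coordinates are expanded one at a time. *)
Lemma multilinear_expand (J : finType) (F : 'I_d -> J -> V) :
  phi [ffun a => \sum_j F a j] = \sum_(p : {ffun 'I_d -> J}) phi [ffun a => F a (p a)].
Proof.
case: (pickP J) => [j0 _|J0]; last first.
  case: (pickP 'I_d) => [a _|d0].
    rewrite (multilinear_eq0 (a := a) phiM); last by rewrite ffunE big_pred0.
    rewrite big1 // => p _; by have := J0 (p a).
  have p0 : {ffun 'I_d -> J}.
    by apply: finfun => a; have := d0 a.
  rewrite (bigD1 p0) //= big1 => [|p]; last first.
    by case/eqP; apply/ffunP=> a; have := d0 a.
  by rewrite addr0; congr phi; apply/ffunP=> a; have := d0 a.
(* On s the sums are left unexpanded, and elsewhere p records the index chosen;
   requiring p to be j0 on s counts each choice off s once. *)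
pose part (s : seq 'I_d) (p : {ffun 'I_d -> J}) :=
  [ffun a => if a \in s then \sum_j F a j else F a (p a)].
pose off (s : seq 'I_d) (p : {ffun 'I_d -> J}) := all (fun a => p a == j0) s.
have main s : uniq s ->
    \sum_(p : {ffun 'I_d -> J} | off s p) phi (part s p) =
    \sum_(p : {ffun 'I_d -> J}) phi [ffun a => F a (p a)].
  elim: s => [_|b s IH /= /andP[bs us]].
    by apply: eq_bigr => p _; congr phi; apply/ffunP=> a; rewrite !ffunE.
  rewrite -IH //.
  pose setp (p : {ffun 'I_d -> J}) j : {ffun 'I_d -> J} :=
    [ffun a => if a == b then j else p a].
  transitivity (\sum_(p : {ffun 'I_d -> J} | off (b :: s) p)
      \sum_j phi (part s (setp p j))).
    apply: eq_bigr => p _.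
    have -> : part (b :: s) p = upd (part s p) b (\sum_j F b j).
      by apply/ffunP=> a; rewrite !ffunE inE; case: eqP => // ->.
    rewrite (lin_sum (phiM b (part s p))); apply: eq_bigr => j _; congr phi.
    apply/ffunP=> a; rewrite !ffunE; case: eqP => // ->.
    by rewrite (negbTE bs).
  rewrite pair_big_dep /=.
  rewrite [RHS](reindex_onto (fun u => setp u.1 u.2) (fun q => (setp q j0, q b))) /=.
    apply: eq_bigl => -[p j] /=; rewrite andbT xpair_eqE.
    have -> : setp p j b = j by rewrite ffunE eqxx.
    have -> : off s (setp p j) = off s p.
      apply: eq_in_all => a asx; rewrite ffunE; case: (a =P b) asx => // ->.
      by rewrite (negbTE bs).
    have -> : (setp (setp p j) j0 == p) = (p b == j0).
      apply/eqP/eqP => [/ffunP/(_ b)|pb]; first by rewrite ffunE eqxx.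
      by apply/ffunP=> a; rewrite !ffunE; case: eqP => // ->.
    by rewrite eqxx andbT andbC.
  by move=> q _; apply/ffunP=> a; rewrite !ffunE; case: eqP => // ->.
rewrite -(main (enum 'I_d) (enum_uniq _)) (big_pred1 [ffun=> j0]) => [|p].
  by congr phi; apply/ffunP=> a; rewrite !ffunE mem_enum.
apply/allP/eqP => [h|-> a _]; last by rewrite ffunE.
by apply/ffunP=> a; rewrite ffunE; apply/eqP/h; rewrite mem_enum.
Qed.
End OneMap.

Lemma tens_expand (V : lmodType k) (J : finType) (F : 'I_d -> J -> V) :
  tens [ffun a => \sum_j F a j] = \sum_(p : {ffun 'I_d -> J}) tens [ffun a => F a (p a)].
Proof. exact: (multilinear_expand (@tens_multilinear k d V)). Qed.

Lemma tens_eq0 (V : lmodType k) (x : {ffun 'I_d -> V}) a : x a = 0 -> tens x = 0.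
Proof. exact/multilinear_eq0/tens_multilinear. Qed.

(** As the pi_j sum to the identity, the tensors of elements of their images span
    the tensor power. *)
Lemma tens_ext_proj (V W : lmodType k) (J : finType) (pi : J -> V -> V)
    (f h : tpow d V -> W) :
  (forall v, v = \sum_j pi j v) -> linear f -> linear h ->
  (forall (p : {ffun 'I_d -> J}) x,
     f (tens [ffun a => pi (p a) (x a)]) = h (tens [ffun a => pi (p a) (x a)])) ->
  f =1 h.
Proof.
move=> piE lf lh fh; apply: tens_ext => // x.
have -> : x = [ffun a => \sum_j pi j (x a)] by apply/ffunP=> a; rewrite ffunE -piE.
rewrite (tens_expand (fun a j => pi j (x a))) !lin_sum //.
by apply: eq_bigr => p _; apply: fh.
Qed.

Lemma lin_id (V : lmodType k) : linear (fun v : V => v). Proof. by []. Qed.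

Lemma linZl (V W : lmodType k) (f : V -> W) (c : k) :
  linear f -> linear (fun v => c *: f v).
Proof. by move=> lf b u v; rewrite lf scalerDr !scalerA [b * c]mulrC. Qed.

Lemma lin_sumf (V W : lmodType k) (I : finType) (F : I -> V -> W) :
  (forall i, linear (F i)) -> linear (fun v => \sum_i F i v).
Proof.
move=> lF c u v; rewrite scaler_sumr -big_split /=.
by apply: eq_bigr => i _; rewrite lF.
Qed.

Definition tmap (V W : lmodType k) (L : 'I_d -> V -> W) : tpow d V -> tpow d W :=
  tlift (fun x => tens [ffun a => L a (x a)]).

Section TensorMap.
Variables (V W : lmodType k) (L : 'I_d -> V -> W).
Hypothesis lL : forall a, linear (L a).

Lemma tmap_multilinear : multilinear (fun x => tens [ffun a => L a (x a)]).
Proof. exact: (multilinear_comp lL (@tens_multilinear k d W)). Qed.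

Lemma tmap_linear : linear (tmap L).
Proof. exact/tlift_linear/tmap_multilinear. Qed.

Lemma tmap_tens x : tmap L (tens x) = tens [ffun a => L a (x a)].
Proof. exact/tlift_tens/tmap_multilinear. Qed.
End TensorMap.

(** The super sign of a product pairs parities of one tensor with parities of the
    other.  It is trivial when one of them has even factors only, even if the
    other is inhomogeneous. *)
Section EvenFactors.
Variables (U V : supermodType k) (W : lmodType k) (B : U -> V -> W).
Hypotheses (Bl : forall y, linear (B^~ y)) (Br : forall x, linear (B x)).

Lemma stbil_evenr (x : {ffun 'I_d -> U}) (y : {ffun 'I_d -> V}) :
  (forall a, homog false (y a)) ->
  stbil B (tens x) (tens y) = tens [ffun a => B (x a) (y a)].
Proof.
move=> hy; have lL a : linear (fun u => B u (y a)) by apply: Bl.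
rewrite -(tmap_tens lL); move: (tens x); apply: homog_tens_ext.
- exact: (stbil_linl Bl).
- exact: tmap_linear.
move=> p {}x hx; rewrite (tmap_tens lL) (stbil_homog (q := [ffun=> false]) Bl Br hx).
  by rewrite sgn2_0r scale1r.
by move=> a; rewrite ffunE.
Qed.

Lemma stbil_evenl (x : {ffun 'I_d -> U}) (y : {ffun 'I_d -> V}) :
  (forall a, homog false (x a)) ->
  stbil B (tens x) (tens y) = tens [ffun a => B (x a) (y a)].
Proof.
move=> hx; have lL a : linear (B (x a)) by apply: Br.
rewrite -(tmap_tens lL); move: (tens y); apply: homog_tens_ext.
- exact: (stbil_linr Br).
- exact: tmap_linear.
move=> q {}y hy; rewrite (tmap_tens lL) (stbil_homog (p := [ffun=> false]) Bl Br _ hy).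
  by rewrite sgn2_0l scale1r.
by move=> a; rewrite ffunE.
Qed.
End EvenFactors.

Lemma pact_even (V : supermodType k) (g : 'S_d) (x : {ffun 'I_d -> V}) :
  (forall a, homog false (x a)) -> pact g (tens x) = tens [ffun a => x (g a)].
Proof.
move=> hx; rewrite (@pact_homog _ _ _ _ [ffun=> false]) ?sgnp0 ?scale1r //.
by move=> a; rewrite ffunE.
Qed.

End MultilinearExpansion.

(** * Twisting the tensor algebra *)

Section Ungraded.
Variables (k : comPzRingType) (d : nat) (A : superalg k).

Lemma ug_even (x : ungraded A) : homog false x. Proof. by []. Qed.

Lemma ug_tensM (x y : {ffun 'I_d -> ungraded A}) :
  (tens x : talg d (ungraded A)) * tens y = tens [ffun a => x a * y a].
Proof. by apply: (stbil_evenr (@saMl _ _) (@saMr _ _)) => a; apply: ug_even. Qed.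

Lemma ug_pact (g : 'S_d) (x : {ffun 'I_d -> ungraded A}) :
  pact g (tens x) = tens [ffun a => x (g a)].
Proof. by apply: pact_even => a; apply: ug_even. Qed.

Lemma tensM_evenr (x y : {ffun 'I_d -> A}) : (forall a, homog false (y a)) ->
  (tens x : talg d A) * tens y = tens [ffun a => x a * y a].
Proof. exact: (stbil_evenr (@saMl _ _) (@saMr _ _)). Qed.

Lemma tensM_evenl (x y : {ffun 'I_d -> A}) : (forall a, homog false (x a)) ->
  (tens x : talg d A) * tens y = tens [ffun a => x a * y a].
Proof. exact: (stbil_evenl (@saMl _ _) (@saMr _ _)). Qed.

End Ungraded.

(** The k-modules A^(tensor d) for A and for its ungraded version are
    convertible, so that the twist below can be an endomap of one of them and
    multiplicative from the unsigned to the signed product. *)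
Section Twist.
Variables (k : comPzRingType) (d : nat) (A : superalg k) (eps : bool -> A).
Hypothesis eps_adapted : adapted_pair eps.
Implicit Types (al be ga : {ffun 'I_d -> bool}) (g h : 'S_d).
Local Notation U := (ungraded A).

Lemma epsM b c : eps b * eps c = if b == c then eps b else 0.
Proof. by case: eps_adapted. Qed.

Lemma eps_sum : \sum_b eps b = 1.
Proof. by case: eps_adapted => _ -> _; rewrite big_bool addrC. Qed.

Lemma eps_homogP b x : homog b x <-> exists u v,
  x = eps false * u * eps b + eps true * v * eps (~~ b).
Proof. by case: eps_adapted. Qed.

Definition corner b c (x : A) := eps b * x * eps c.

Lemma homog_corner b c x : homog (b (+) c) (corner b c x).
Proof.
apply/eps_homogP; case: b => /=; [exists 0, x|exists x, 0];
  by rewrite !(mulr0, mul0r, addr0, add0r) ?negbK.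
Qed.

Lemma eps_even b : homog false (eps b).
Proof. by have := homog_corner b b 1; rewrite addbb /corner mulr1 epsM eqxx. Qed.

Lemma corner_linear b c : linear (corner b c).
Proof.
by move=> s x y; rewrite /corner mulrDr mulrDl -sascaleAr -sascaleAl.
Qed.

Lemma corner_sum x : x = \sum_(j : bool * bool) corner j.1 j.2 x.
Proof.
rewrite -(pair_bigA _ (fun b c => corner b c x)) /=.
under eq_bigr => b _ do rewrite -mulr_sumr eps_sum mulr1.
by rewrite -mulr_suml eps_sum mul1r.
Qed.

Lemma cornerM b c b' c' x y :
  corner b c x * corner b' c' y = if c == b' then corner b c' (x * eps c * y) else 0.
Proof.
rewrite /corner mulrA -!mulrA [eps c * (eps b' * _)]mulrA epsM.
by case: eqP => _; rewrite ?(mul0r, mulr0).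
Qed.

Lemma corner_corner b c b' c' x :
  corner b c (corner b' c' x) = if (b == b') && (c == c') then corner b c x else 0.
Proof.
rewrite /corner !mulrA epsM -!mulrA epsM.
case: eqP => [_|_] /=; last by rewrite mul0r.
by rewrite [c' == c]eq_sym; case: eqP => [<-|_]; rewrite ?mulr0.
Qed.

Lemma homog_eps b c (x : A) : homog b x -> x * eps c = corner (c (+) b) c x.
Proof.
case/eps_homogP => u [v ->]; rewrite /corner mulrDl mulrDr mulrDl.
rewrite !mulrA !epsM; case: b; case: c; rewrite /= ?(mul0r, addr0, add0r);
  rewrite -!mulrA !epsM /= ?(mulr0, addr0, add0r) //.
Qed.

Definition cornered al be (x : {ffun 'I_d -> A}) :=
  forall a, corner (al a) (be a) (x a) = x a.

Lemma cornered_homog al be x : cornered al be x ->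
  forall a, homog ([ffun a => al a (+) be a] a) (x a).
Proof. by move=> hx a; rewrite ffunE -hx; apply: homog_corner. Qed.

Lemma cornered_ext (W : lmodType k) (f h : talg d A -> W) :
  linear f -> linear h ->
  (forall al be x, cornered al be x -> f (tens x) = h (tens x)) -> f =1 h.
Proof.
move=> lf lh fh; apply: (tens_ext_proj corner_sum lf lh) => p x.
apply: (fh [ffun a => (p a).1] [ffun a => (p a).2]) => a.
by rewrite !ffunE corner_corner !eqxx.
Qed.

(** On corners the product x_1[1] ... x_d[d] of the images of the x_a under
    sigma is the tensor of the x_a gamma^(sum of the parities of x_c, c > a),
    and gamma acts on the right of A e^(be_a) as (-1)^(be_a): this is the sign. *)
Definition twist (u : talg d A) : talg d A :=
  \sum_(al : {ffun 'I_d -> bool}) \sum_(be : {ffun 'I_d -> bool})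
    (-1) ^+ sgn2 [ffun a => al a (+) be a] be *: tmap (fun a => corner (al a) (be a)) u.

Lemma twist_linear : linear twist.
Proof.
do 2![apply: lin_sumf => ?]; apply: linZl.
by apply: tmap_linear => a; apply: corner_linear.
Qed.

Lemma twist_cornered al be x : cornered al be x ->
  twist (tens x) = (-1) ^+ sgn2 [ffun a => al a (+) be a] be *: tens x.
Proof.
move=> hx; have lc al' be' a := @corner_linear (al' a) (be' a).
rewrite /twist (bigD1 al) //= [X in _ + X]big1 => [|al' /ffun_neqP[a ne]].
  rewrite (bigD1 be) //= big1 => [|be' /ffun_neqP[a ne]].
    rewrite !addr0 (tmap_tens (lc _ _)); congr (_ *: tens _).
    by apply/ffunP=> a; rewrite ffunE hx.
  rewrite (tmap_tens (lc _ _)) (tens_eq0 (a := a)) ?scaler0 //.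
  by rewrite ffunE -hx corner_corner (negbTE ne) andbF.
rewrite big1 // => be' _; rewrite (tmap_tens (lc _ _)) (tens_eq0 (a := a)) ?scaler0 //.
by rewrite ffunE -hx corner_corner (negbTE ne).
Qed.

Lemma twistK : involutive twist.
Proof.
apply: cornered_ext => [||al be x hx]; [|by move=> c u v|].
  exact: (linear_comp twist_linear twist_linear).
rewrite (twist_cornered hx) (linearZ_of _ _ twist_linear) (twist_cornered hx).
by rewrite scalerA -expr2 sqrr_sign scale1r.
Qed.

(** Both sides vanish unless the corners of x and y are composable, that is of
    types (al, be) and (be, ga); then the signs agree by bilinearity of sgn2. *)
Lemma twistM (s t : talg d U) : twist (s * t) = twist s * twist t.
Proof.
move: s; apply: cornered_ext => [||al be x hx].
- exact: (linear_comp twist_linear (stbil_linl (@saMl _ U) t)).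
- exact: (linear_comp (stbil_linl (@saMl _ A) _) twist_linear).
move: t; apply: cornered_ext => [||be' ga y hy].
- exact: (linear_comp twist_linear (stbil_linr (@saMr _ U) _)).
- exact: (linear_comp (stbil_linr (@saMr _ A) _) twist_linear).
rewrite (twist_cornered hx) (twist_cornered hy) -talgZl -talgZr ug_tensM.
have -> : (tens x : talg d A) * tens y = _ :=
  stbil_homog (@saMl _ A) (@saMr _ A) (cornered_homog hx) (cornered_homog hy).
have [e|/ffun_neqP[a ne]] := eqVneq be be'; last first.
  have xy0 : x a * y a = 0 by rewrite -hx -hy cornerM (negbTE ne).
  rewrite !(tens_eq0 (a := a)) ?ffunE ?(lin0 twist_linear) ?scaler0 //.
subst be'; rewrite (twist_cornered (al := al) (be := ga)); last first.
  by move=> a; rewrite ffunE -[in LHS]hx -[in LHS]hy cornerM eqxx corner_corner !eqxx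
     -[in RHS]hx -[in RHS]hy cornerM eqxx.
rewrite !scalerA -!signr_addb; congr ((-1) ^+ (nat_of_bool _) *: _).
rewrite !sgn2Dl !sgn2Dr.
by move: (sgn2 al ga) (sgn2 ga ga) (sgn2 al be) (sgn2 be be) (sgn2 be ga); do 5!case.
Qed.

(** The idempotents e^ga, with which the sums over parities in the formulas for
    sigma are compared one term at a time. *)
Definition idem ga : talg d A := tens [ffun a => eps (ga a)].

Lemma idem_cornered ga : cornered ga ga [ffun a => eps (ga a)].
Proof. by move=> a; rewrite ffunE /corner !epsM eqxx epsM eqxx. Qed.

Lemma idem_sum : \sum_(ga : {ffun 'I_d -> bool}) idem ga = 1.
Proof.
rewrite /idem -(tens_expand (fun _ b => eps b)); congr tens.
by apply/ffunP=> a; rewrite !ffunE eps_sum.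
Qed.

Lemma idem_even ga a : homog false ([ffun a => eps (ga a)] a : A).
Proof. by rewrite ffunE; apply: eps_even. Qed.

Lemma idemMl ga al be x : cornered al be x ->
  idem ga * tens x = if ga == al then tens x else 0.
Proof.
move=> hx; rewrite /idem (tensM_evenl _ (@idem_even ga)).
case: eqVneq => [->|/ffun_neqP[a ne]].
  by congr tens; apply/ffunP=> a; rewrite !ffunE -hx /corner !mulrA epsM eqxx.
by rewrite (tens_eq0 (a := a)) // !ffunE -hx /corner !mulrA epsM (negbTE ne) !mul0r.
Qed.

Lemma idemMr ga al be x : cornered al be x ->
  (tens x : talg d A) * idem ga = if be == ga then tens x else 0.
Proof.
move=> hx; rewrite /idem (tensM_evenr _ (@idem_even ga)).
case: eqVneq => [<-|/ffun_neqP[a ne]].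
  by congr tens; apply/ffunP=> a; rewrite !ffunE -hx /corner -!mulrA epsM eqxx.
by rewrite (tens_eq0 (a := a)) // !ffunE -hx /corner -!mulrA epsM (negbTE ne) !mulr0.
Qed.

Lemma twist_idem ga : twist (idem ga) = idem ga.
Proof.
rewrite (twist_cornered (idem_cornered ga)) -[RHS]scale1r; congr (_ *: _).
have -> : [ffun a => ga a (+) ga a] = [ffun=> false] by apply/ffunP=> a; rewrite !ffunE addbb.
by rewrite sgn2_0l.
Qed.

Lemma twist1 : twist 1 = 1.
Proof.
by rewrite -idem_sum (lin_sum twist_linear); apply: eq_bigr => ga _; apply: twist_idem.
Qed.

Lemma pact_idem g ga : pact g (idem ga) = idem [ffun a => ga (g a)].
Proof.
by rewrite (pact_even _ (@idem_even ga)); congr tens; apply/ffunP=> a; rewrite !ffunE.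
Qed.

(** The element D_g with sigma(g) = D_g g.  For an adjacent transposition it is
    the combination of the e^(b, c)[r] in the definition of sigma. *)
Definition perm_sign g : talg d A := \sum_(ga : {ffun 'I_d -> bool}) (-1) ^+ sgnp g ga *: idem ga.

Lemma perm_signMl g al be x : cornered al be x ->
  perm_sign g * tens x = (-1) ^+ sgnp g al *: (tens x : talg d A).
Proof.
move=> hx; rewrite /perm_sign mulr_suml (bigD1 al) //= big1 => [|ga ne].
  by rewrite addr0 -talgZl (idemMl _ hx) eqxx.
by rewrite -talgZl (idemMl _ hx) (negbTE ne) scaler0.
Qed.

Lemma perm_signMr g al be x : cornered al be x ->
  (tens x : talg d A) * perm_sign g = (-1) ^+ sgnp g be *: (tens x : talg d A).
Proof.
move=> hx; rewrite /perm_sign mulr_sumr (bigD1 be) //= big1 => [|ga ne].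
  by rewrite addr0 -talgZr (idemMr _ hx) eqxx.
by rewrite -talgZr (idemMr _ hx) eq_sym (negbTE ne) scaler0.
Qed.

Lemma perm_sign1 : perm_sign 1%g = 1.
Proof. by rewrite -idem_sum; apply: eq_bigr => ga _; rewrite sgnp1 scale1r. Qed.

Lemma perm_sign_sqr g : perm_sign g * perm_sign g = 1.
Proof.
rewrite {2}/perm_sign mulr_sumr -idem_sum; apply: eq_bigr => ga _.
by rewrite -talgZr (perm_signMl _ (idem_cornered ga)) scalerA -expr2 sqrr_sign scale1r.
Qed.

(** Permuting factors and permuting them back costs the same sign twice. *)
Lemma sgnpV g (p : {ffun 'I_d -> bool}) : sgnp g^-1%g [ffun a => p (g a)] = sgnp g p.
Proof.
have := sgnpM g g^-1%g p; rewrite mulVg sgnp1.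
by case: (sgnp g p); case: (sgnp _ _).
Qed.

(** The coefficient of e^ga is the cocycle identity for the signs in the action
    of the symmetric group, which expresses that sigma(g) sigma(h) is the image
    of the product of g and h. *)
Lemma perm_signM g h : perm_sign g * pact g^-1%g (perm_sign h) = perm_sign (h * g)%g.
Proof.
have lp := @pact_linear k d A g^-1%g.
rewrite {2}/perm_sign (lin_sum lp) mulr_sumr.
pose f (ga : {ffun 'I_d -> bool}) : {ffun 'I_d -> bool} := [ffun a => ga (g a)].
pose f' (ga : {ffun 'I_d -> bool}) : {ffun 'I_d -> bool} := [ffun a => ga (g^-1%g a)].
rewrite (reindex f); last first.
  exists f' => ga _; apply/ffunP=> a; rewrite !ffunE ?permK ?permKV //.
apply: eq_bigr => ga _; rewrite (linearZ_of _ _ lp) pact_idem -talgZr.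
have -> : [ffun a => f ga (g^-1%g a)] = ga by apply/ffunP=> a; rewrite !ffunE permKV.
rewrite (perm_signMl _ (idem_cornered ga)) scalerA -signr_addb -sgnpM.
by rewrite addbC.
Qed.

(** This expresses that sigma respects the commutation of permutations with
    tensors; on corners it is the compatibility of the sign of a permutation
    with the sign of a product. *)
Lemma perm_sign_pact g (u : talg d U) :
  perm_sign g * pact g^-1%g (twist u) = twist (@pact k d U g^-1%g u) * perm_sign g.
Proof.
have lpA := @pact_linear k d A g^-1%g; have lpU := @pact_linear k d U g^-1%g.
move: u; apply: cornered_ext => [||al be x hx].
- exact: (linear_comp (stbil_linr (@saMr _ A) _) (linear_comp lpA twist_linear)).
- exact: (linear_comp (stbil_linl (@saMl _ A) _) (linear_comp twist_linear lpU)).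
rewrite (twist_cornered hx) (linearZ_of _ _ lpA) (pact_homog _ (cornered_homog hx)).
rewrite ug_pact.
have hx' : cornered [ffun a => al (g^-1%g a)] [ffun a => be (g^-1%g a)]
    [ffun a => x (g^-1%g a)] by move=> a; rewrite !ffunE hx.
rewrite (twist_cornered hx') -talgZl -!talgZr (perm_signMr _ hx') (perm_signMl _ hx').
rewrite !scalerA -!signr_addb; congr ((-1) ^+ (nat_of_bool _) *: _).
have sg (p : {ffun 'I_d -> bool}) : sgnp g [ffun a => p (g^-1%g a)] = sgnp g^-1%g p.
  by have := sgnpV g^-1%g p; rewrite invgK.
rewrite !sg; have := sgnp_sgn2 g^-1%g [ffun a => al a (+) be a] be.
have -> : [ffun a => [ffun a0 => al a0 (+) be a0] a (+) be a] = al.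
  by apply/ffunP=> a; rewrite !ffunE -addbA addbb addbF.
have -> : [ffun a => [ffun a0 => al a0 (+) be a0] (g^-1%g a)] =
    [ffun a => [ffun a0 => al (g^-1%g a0)] a (+) [ffun a0 => be (g^-1%g a0)] a].
  by apply/ffunP=> a; rewrite !ffunE.
move: (sgn2 _ _) (sgnp g^-1%g _) (sgn2 _ be) (sgnp g^-1%g be) (sgnp g^-1%g al).
by do 5!case.
Qed.

(** Since D_g stands to the left of g, sigma acts coordinatewise on functions on
    the symmetric group. *)
Definition sigma_map (f : wreath d U) : wreath d A := [ffun g => twist (f g) * perm_sign g].

Lemma sigma_map_linear : linear sigma_map.
Proof.
move=> c f h; apply/ffunP=> g; rewrite !ffunE.
by rewrite twist_linear mulrDl talgZl.
Qed.

Lemma sigma_map_wtens u g : sigma_map (wtens u g) = wtens (twist u * perm_sign g) g.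
Proof.
apply/ffunP=> h; rewrite !ffunE; case: eqP => [->//|_].
by rewrite (lin0 twist_linear) mul0r.
Qed.

Lemma sigma_map_monoid : GRing.monoid_morphism sigma_map.
Proof.
split; first by rewrite [LHS]sigma_map_wtens twist1 perm_sign1 mulr1.
move=> f h; apply/ffunP=> m; rewrite !ffunE (lin_sum twist_linear) mulr_suml.
apply: eq_bigr => g _; rewrite !ffunE twistM pact_mul -!mulrA; congr (_ * _).
rewrite [in RHS]mulrA perm_sign_pact -mulrA; congr (_ * _).
by rewrite perm_signM mulgKV.
Qed.

Lemma sigma_map_bij : bijective sigma_map.
Proof.
pose inv (w : wreath d A) : wreath d U := [ffun g => twist (w g * perm_sign g)].
exists inv => w; apply/ffunP=> g.
  by rewrite !ffunE -mulrA perm_sign_sqr mulr1 twistK.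
by rewrite !ffunE twistK -mulrA perm_sign_sqr mulr1.
Qed.

(** Tensors can be compared after multiplication by each e^ga, since these sum
    to 1. *)
Lemma talg_idem_ext (u v : talg d A) : (forall ga, u * idem ga = v * idem ga) -> u = v.
Proof.
move=> h; rewrite -[u]mulr1 -[v]mulr1 -idem_sum !mulr_sumr.
by apply: eq_bigr => ga _; apply: h.
Qed.

End Twist.

(** * Characterization of sigma *)

Section WreathGenerators.
Variables (k : comPzRingType) (d : nat) (B : superalg k).
Local Notation W := (wreath d B).

Lemma wtens_linear (g : 'S_d) : linear (fun u => wtens u g : W).
Proof.
move=> c u v; apply/ffunP=> h; rewrite !ffunE.
by case: eqP => // _; rewrite scaler0 addr0.
Qed.

Lemma winc_linear : linear (@winc k d B). Proof. exact: wtens_linear. Qed.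

Lemma wincM (u v : talg d B) : winc (u * v) = winc u * winc v.
Proof. by rewrite /winc wtensM invg1 pact1 mul1g. Qed.

Lemma wtens_winc (u v : talg d B) g :
  wtens u g * winc v = wtens (u * pact g^-1%g v) g.
Proof. by rewrite /winc wtensM mul1g. Qed.

Lemma wtens1M (g h : 'S_d) : wtens 1 g * wtens 1 h = wtens 1 (h * g)%g :> W.
Proof. by rewrite wtensM pact_one mulr1. Qed.

Lemma wreath_sum (w : W) : w = \sum_g wtens (w g) g.
Proof.
apply/ffunP=> h; rewrite sum_ffunE (bigD1 h) //= big1 => [|g /negbTE ne].
  by rewrite ffunE eqxx addr0.
by rewrite ffunE eq_sym ne.
Qed.

Lemma wreath_ext (M : lmodType k) (f h : W -> M) : linear f -> linear h ->
  (forall g x, f (wtens 1 g * winc (tens x)) = h (wtens 1 g * winc (tens x))) ->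
  f =1 h.
Proof.
move=> lf lh fh w; rewrite [w]wreath_sum !lin_sum //; apply: eq_bigr => g _.
have -> : wtens (w g) g = wtens 1 g * winc (pact g (w g)) :> W.
  by rewrite wtens_winc pactM mul1r mulVg pact1.
have lw : linear (fun u : talg d B => wtens 1 g * winc u : W).
  by move=> c u v; rewrite winc_linear mulrDr wreathZr.
move: (pact g (w g)); apply: tens_ext => [||x]; last exact: fh.
  exact: (linear_comp lf lw).
exact: (linear_comp lh lw).
Qed.

Lemma at_pos_linear (t : 'I_d) : linear (fun x : B => at_pos x t).
Proof.
move=> c x y; pose o : {ffun 'I_d -> B} := [ffun=> 1].
have E z : at_pos z t = tens (upd o t z).
  by congr tens; apply/ffunP=> a; rewrite !ffunE.
by rewrite !E; apply: tens_multilinear.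
Qed.

End WreathGenerators.

(** The transposition (a, b+1) is the conjugate of (a, b) by (b, b+1), and the
    transpositions generate the symmetric group. *)
Lemma perm_ind_adjacent d (P : 'S_d -> Prop) :
  P 1%g -> (forall g h, P g -> P h -> P (g * h)%g) ->
  (forall r r' : 'I_d, r' = r.+1 :> nat -> P (tperm r r')) ->
  forall g, P g.
Proof.
move=> P1 PM Pt.
have Plt m (a b : 'I_d) : b = (a + m.+1)%N :> nat -> P (tperm a b).
  elim: m b => [|m IH] b ab; first by apply: Pt; rewrite ab addn1.
  have lt : (a + m.+1 < d)%N by have := ltn_ord b; lia.
  have /PM := Pt (Ordinal lt) b ltac:(move: ab => /=; lia).
  move/(_ _ (IH (Ordinal lt) erefl)) => H.
  have {H} := PM _ _ H (Pt (Ordinal lt) b ltac:(move: ab => /=; lia)).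
  rewrite -mulgA -{1}tpermV -conjgE tpermJ tpermL tpermD //;
    by rewrite -val_eqE /=; lia.
move=> g; have [ts -> _] := prod_tpermP g.
elim: ts => [|[a b] ts IH]; rewrite ?big_nil ?big_cons //=.
apply: PM => //; case: (ltngtP a b) => ab.
- by apply: (Plt (b - a).-1); lia.
- by rewrite tpermC; apply: (Plt (a - b).-1); lia.
- by rewrite (val_inj ab) tperm1.
Qed.

Section UngradedGenerators.
Variables (k : comPzRingType) (d : nat) (A : superalg k).
Local Notation U := (ungraded A).

Lemma tens_prod (x : {ffun 'I_d -> U}) :
  tens x = \prod_(t <- enum 'I_d) at_pos (x t) t.
Proof.
suff H s : uniq s -> \prod_(t <- s) at_pos (x t) t =
    tens [ffun a => if a \in s then x a else 1] :> talg d U.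
  rewrite H ?enum_uniq //; congr tens; apply/ffunP=> a.
  by rewrite ffunE mem_enum.
elim: s => [_|b s IH /= /andP[bs us]].
  by rewrite big_nil; congr tens; apply/ffunP=> a; rewrite !ffunE.
rewrite big_cons IH // ug_tensM; congr tens; apply/ffunP=> a; rewrite !ffunE inE.
by case: (eqVneq a b) => [->|_] /=; rewrite ?(negbTE bs) ?mulr1 ?mul1r.
Qed.

Lemma is_sigma_inj (eps : bool -> A) (sigma tau : wreath d U -> wreath d A) :
  is_sigma eps sigma -> is_sigma eps tau -> sigma =1 tau.
Proof.
case=> -[ls [s1 sM] _] sp st [[lt [t1 tM] _] tp tt].
apply: wreath_ext => // g x; rewrite sM tM; congr (_ * _).
  move: g; apply: perm_ind_adjacent => [|g h eg eh|r r' rr'].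
  - exact: (etrans s1 (esym t1)).
  - by rewrite -wtens1M sM tM eg eh.
  - by rewrite st // tt.
rewrite tens_prod; elim: (enum _) => [|t s IH].
  by rewrite !big_nil; exact: (etrans s1 (esym t1)).
rewrite !big_cons wincM sM tM IH; congr (_ * _).
rewrite -(hpartD (x t : A)) -[hpart false _]scale1r.
have la := @at_pos_linear k d U t.
have h b := homog_hpart b (x t : A).
by rewrite (la 1) winc_linear ls lt !(sp _ _ _ (h _)) !(tp _ _ _ (h _)).
Qed.

End UngradedGenerators.

Section IsSigma.
Variables (k : comPzRingType) (d : nat) (A : superalg k) (eps : bool -> A).
Hypothesis eps_adapted : adapted_pair eps.
Local Notation U := (ungraded A).

(** Multiplied by e^ga on the right, both sides become the same corner tensor:
    of the sum over the idempotents before t only the term of ga survives. *)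
Lemma twist_at_pos (x : A) b (t : 'I_d) : homog b x ->
  twist eps (at_pos x t) = sigma_at eps x b t.
Proof.
move=> hx; apply: (talg_idem_ext eps_adapted) => ga.
rewrite -{1}(twist_idem eps_adapted ga) -(twistM eps_adapted) [_ * _]ug_tensM.
(* The left corner differs from ga at t only, by the parity of x. *)
pose al := [ffun a => if a == t then ga a (+) b else ga a].
rewrite (twist_cornered eps_adapted (al := al) (be := ga)); last first.
  move=> a; rewrite !ffunE; case: eqP => _.
    by rewrite [_ * _](homog_eps eps_adapted _ hx) corner_corner // !eqxx.
  by rewrite mul1r /corner !(epsM eps_adapted) eqxx (epsM eps_adapted) eqxx.
have even := idem_even eps_adapted ga.
rewrite /sigma_at mulr_suml.
pose s0 : {ffun 'I_t -> bool} := [ffun j => ga (widen_ord (ltnW (ltn_ord t)) j)].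
rewrite (bigD1 s0) //= [X in _ + X]big1 => [|s ne]; last first.
  have [j nej] := ffun_neqP ne.
  pose a := widen_ord (ltnW (ltn_ord t)) j.
  rewrite -talgZl (tensM_evenr _ even) (tens_eq0 (a := a)) ?scaler0 //.
  rewrite !ffunE; case: insubP => [i _ e /=|]; last by rewrite /= ltn_ord.
  have -> : i = j by apply: val_inj.
  by rewrite (epsM eps_adapted); move: nej; rewrite ffunE => /negbTE ->.
rewrite addr0 -talgZl (tensM_evenr _ even); congr ((-1) ^+ (nat_of_bool _) *: tens _).
  rewrite /sgn2 -(pair_big_dep xpredT (fun a c : 'I_d => (a < c)%N)
    (fun a c => [ffun a => al a (+) ga a] c && ga a)) /=.
  transitivity (\big[addb/false]_(a < d | (a < t)%N) (ga a && b)).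
    rewrite [RHS]big_mkcond; apply: eq_bigr => a _.
    have F (c : 'I_d) : [ffun a => al a (+) ga a] c && ga a = (c == t) && (ga a && b).
      rewrite !ffunE; case: eqP => _ /=; last by rewrite addbb.
      by rewrite addbC addKb andbC.
    under eq_bigr => c _ do rewrite F.
    case: ifP => lt; last by rewrite big1 // => c ac; case: eqP ac => // ->; rewrite lt.
    by rewrite (bigD1 t) //= eqxx big1 ?addbF // => c /andP[_ /negbTE ->].
  rewrite (big_ord_narrow (ltnW (ltn_ord t))) big_distrl /=.
  by apply: eq_bigr => j _; rewrite ffunE.
apply/ffunP=> a; rewrite !ffunE; case: insubP => [j lt ja|] /=.
  rewrite ffunE (epsM eps_adapted); have -> : widen_ord (ltnW (ltn_ord t)) j = a.
    exact: val_inj.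
  by rewrite eqxx -val_eqE ltn_eqF // mul1r.
by [].
Qed.

Lemma sgnp_adjacent (r r' : 'I_d) (p : {ffun 'I_d -> bool}) : r' = r.+1 :> nat ->
  sgnp (tperm r r') p = p r && p r'.
Proof.
move=> rr'; rewrite /sgnp (big_pred1 (r, r')) // => -[a c] /=.
rewrite tpermV xpair_eqE -!val_eqE /=.
by case: tpermP => [->|->|/eqP + /eqP +]; case: tpermP => [->|->|/eqP + /eqP +];
  rewrite -?val_eqE /=; lia.
Qed.

Lemma at_eps_idem b (r : 'I_d) ga :
  at_pos (eps b) r * idem eps ga = if b == ga r then idem eps ga else 0.
Proof.
have even := idem_even eps_adapted ga.
rewrite /idem (tensM_evenr _ even); case: eqVneq => [->|ne].
  congr tens; apply/ffunP=> a; rewrite !ffunE; case: eqP => [->|_].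
    by rewrite (epsM eps_adapted) eqxx.
  by rewrite mul1r.
by rewrite (tens_eq0 (a := r)) // !ffunE eqxx (epsM eps_adapted) (negbTE ne).
Qed.

Lemma sigma_map_is_sigma : is_sigma eps (@sigma_map k d A eps).
Proof.
split.
- split; [exact: sigma_map_linear|exact: sigma_map_monoid|exact: sigma_map_bij].
- move=> t b x hx; rewrite [LHS]sigma_map_wtens (perm_sign1 _ eps_adapted) mulr1.
  by rewrite -(twist_at_pos _ hx).
move=> r r' rr'; rewrite [LHS]sigma_map_wtens (twist1 _ eps_adapted) mul1r.
pose y b c := at_pos (eps b) r * at_pos (eps c) r'.
pose Y := y false false + y false true + y true false - y true true.
have -> : eps2 eps false false r r' + eps2 eps false true r r' +
   eps2 eps true false r r' - eps2 eps true true r r' = winc Y.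
  by apply/ffunP=> h; rewrite !ffunE; case: eqP; rewrite ?addr0 ?subr0.
rewrite wtens_winc mul1r; set s := tperm r r'.
suff -> : Y = perm_sign eps s.
  congr wtens; rewrite -[RHS](@mul1r (talg d A)) -(perm_sign_sqr eps_adapted s) -mulrA.
  by rewrite (perm_signM eps_adapted) tperm2 (perm_sign1 _ eps_adapted) mulr1.
apply: (talg_idem_ext eps_adapted) => ga.
rewrite (perm_signMl eps_adapted _ (idem_cornered eps_adapted ga)) sgnp_adjacent //.
rewrite /Y mulrBl !mulrDl /y -!mulrA !at_eps_idem.
rewrite -/(idem eps ga).
case: (ga r') => /=; rewrite !mulr0 !at_eps_idem; case: (ga r) => /=;
  by rewrite ?scale1r ?scaleN1r ?addr0 ?add0r ?subr0 ?sub0r.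
Qed.

End IsSigma.

(** * Endomorphisms of tensor space *)

Section Actions.
Variables (k : comPzRingType) (A : superalg k) (n d : nat).
Local Notation V := (smx A n 1).
Local Notation W := (wreath d A).
Local Notation T := (talg d (Msuper A n)).
Implicit Types (v : tpow d V) (w : W) (y : T) (g h : 'S_d).

Lemma scalr_linl (a : A) : linear (fun u : V => scalr u a).
Proof.
move=> c u v; apply/matrixP=> i j; rewrite !(mxE, smxZE).
by rewrite mulrDl sascaleAl.
Qed.

Lemma scalr_linr (u : V) : linear (fun a : A => scalr u a).
Proof.
move=> c a b; apply/matrixP=> i j; rewrite !(mxE, smxZE).
by rewrite mulrDr sascaleAr.
Qed.

Lemma homog_scalr b c (u : V) (a : A) :
  homog b u -> homog c a -> homog (b (+) c) (scalr u a : V).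
Proof. by move=> /smx_homogP hu ha; apply/smx_homogP=> i j; rewrite mxE; apply: homogM. Qed.

Lemma scalrA (u : V) (a b : A) : scalr (scalr u a) b = scalr u (a * b).
Proof. by apply/matrixP=> i j; rewrite !mxE mulrA. Qed.

Lemma scalr1 (u : V) : scalr u (1 : A) = u.
Proof. by apply/matrixP=> i j; rewrite !mxE mulr1. Qed.

Local Notation sm := (fun (x : Msuper A n) (u : V) => smul x u : V).

Lemma sm_linl (u : V) : linear (sm^~ u).
Proof. exact: smulPl. Qed.

Lemma sm_linr (x : Msuper A n) : linear (sm x).
Proof. exact: smulPr. Qed.

Lemma homog_sm b c (x : Msuper A n) (u : V) :
  homog b x -> homog c u -> homog (b (+) c) (sm x u).
Proof. exact: homog_smul. Qed.

Lemma smulA (x y : Msuper A n) (u : V) : sm (x * y) u = sm x (sm y u).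
Proof. by rewrite /smul mulmxA. Qed.

Lemma smul_scalr (x : Msuper A n) (u : V) (a : A) :
  scalr (sm x u) a = sm x (scalr u a).
Proof.
apply/matrixP=> i j; rewrite !mxE mulr_suml; apply: eq_bigr => s _.
by rewrite !mxE mulrA.
Qed.

Definition tscal v (x : talg d A) : tpow d V := stbil (fun (u : V) (a : A) => scalr u a) v x.

Lemma tscal_linl x : linear (tscal^~ x).
Proof. exact: (stbil_linl scalr_linl). Qed.

Lemma tscal_linr v : linear (tscal v).
Proof. exact: (stbil_linr scalr_linr). Qed.

Lemma tscalM v (x x' : talg d A) : tscal (tscal v x) x' = tscal v (x * x').
Proof.
apply: stbilA; first [exact: scalr_linl | exact: scalr_linr | exact: saMl
  | exact: saMr | exact: homog_scalr | exact: homogM | exact: scalrA].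
Qed.

Lemma pact_tscal g v x : pact g (tscal v x) = tscal (pact g v) (pact g x).
Proof. exact: (pact_stbil scalr_linl scalr_linr homog_scalr). Qed.

Lemma tscal_evenl (x : {ffun 'I_d -> V}) (y : {ffun 'I_d -> A}) :
  (forall a, homog false (x a)) ->
  tscal (tens x) (tens y) = tens [ffun a => scalr (x a) (y a) : V].
Proof. exact: (stbil_evenl scalr_linl scalr_linr). Qed.

Lemma tscal1 v : tscal v 1 = v.
Proof.
have even (a : 'I_d) : homog false (([ffun=> 1] : {ffun 'I_d -> A}) a).
  by rewrite ffunE; apply: homog1.
move: v; apply: tens_ext => [||x]; [exact: tscal_linl|exact: lin_id|].
have -> : tscal (tens x) 1 = _ := stbil_evenr scalr_linl scalr_linr x even.
by congr tens; apply/ffunP=> a; rewrite !ffunE scalr1.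
Qed.

Lemma right_act_wtens v x g : right_act v (wtens x g) = pact g (tscal v x).
Proof.
rewrite /right_act (bigD1 g) //= big1 => [|h /negbTE ne].
  by rewrite addr0 ffunE eqxx.
by rewrite ffunE ne -/(tscal _ _) (lin0 (tscal_linr v)) (lin0 (@pact_linear _ _ _ h)).
Qed.

Lemma right_act_winc v x : right_act v (winc x) = tscal v x.
Proof. by rewrite [LHS]right_act_wtens pact1. Qed.

Lemma right_act_linl w : linear (fun v => right_act v w).
Proof.
apply: lin_sumf => g.
exact: (linear_comp (@pact_linear _ _ _ g) (tscal_linl (w g))).
Qed.

Lemma right_act_suml (I : Type) (r : seq I) (P : pred I) (F : I -> tpow d V) w :
  right_act (\sum_(i <- r | P i) F i) w = \sum_(i <- r | P i) right_act (F i) w.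
Proof. exact: (lin_sum (right_act_linl w)). Qed.

Lemma right_act_linr v : linear (right_act v).
Proof.
move=> c w w'; rewrite /right_act scaler_sumr -big_split /=; apply: eq_bigr => g _.
by rewrite !ffunE (linear_comp (@pact_linear _ _ _ g) (tscal_linr v)).
Qed.

Lemma right_actM v w w' : right_act (right_act v w) w' = right_act v (w * w').
Proof.
rewrite [w]wreath_sum [w']wreath_sum mulr_suml !(lin_sum (right_act_linr _)).
under [RHS]eq_bigr => g _ do rewrite mulr_sumr (lin_sum (right_act_linr _)).
rewrite [RHS]exchange_big; apply: eq_bigr => h _.
rewrite right_act_suml; apply: eq_bigr => g _.
rewrite wtensM !right_act_wtens -pactM -tscalM [in RHS]pact_tscal pactM.
by rewrite mulgV pact1.
Qed.

Lemma right_act1 v : right_act v 1 = v.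
Proof. by rewrite [LHS]right_act_winc tscal1. Qed.

Lemma left_act_linl v : linear (fun y => left_act y v).
Proof. exact: (stbil_linl sm_linl). Qed.

Lemma left_act_suml (I : Type) (r : seq I) (P : pred I) (F : I -> T) v :
  left_act (\sum_(i <- r | P i) F i) v = \sum_(i <- r | P i) left_act (F i) v.
Proof. exact: (lin_sum (left_act_linl v)). Qed.

Lemma left_act_linr y : linear (left_act y).
Proof. exact: (stbil_linr sm_linr). Qed.

Lemma left_actM y y' v : left_act (y * y') v = left_act y (left_act y' v).
Proof.
apply: stbilA; first [exact: sm_linl | exact: sm_linr | exact: saMl
  | exact: saMr | exact: homog_sm | exact: homogM | exact: smulA].
Qed.

Lemma left_act1 v : left_act 1 v = v.
Proof.
have even (a : 'I_d) : homog false (([ffun=> 1] : {ffun 'I_d -> Msuper A n}) a).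
  by rewrite ffunE; apply: homog1.
move: v; apply: tens_ext => [||x]; [exact: left_act_linr|exact: lin_id|].
have -> : left_act 1 (tens x) = _ := stbil_evenl sm_linl sm_linr x even.
by congr tens; apply/ffunP=> a; rewrite !ffunE /smul mul1mx.
Qed.

Lemma left_act_tscal y v x : left_act y (tscal v x) = tscal (left_act y v) x.
Proof.
apply/esym/stbilA; first [exact: sm_linl | exact: sm_linr | exact: scalr_linl
  | exact: scalr_linr | exact: homog_sm | exact: homog_scalr | exact: smul_scalr].
Qed.

Lemma pact_left_act g y v : pact g (left_act y v) = left_act (pact g y) (pact g v).
Proof. exact: (pact_stbil sm_linl sm_linr homog_sm). Qed.

Lemma left_right_act y v w : Defs.invariant y ->
  left_act y (right_act v w) = right_act (left_act y v) w.
Proof.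
move=> /forallP hy; rewrite /right_act (lin_sum (left_act_linr y)).
apply: eq_bigr => g _; rewrite -{1}(eqP (hy g)) -pact_left_act.
by rewrite -/(tscal _ _) left_act_tscal.
Qed.

(** The tensors [bten r] of standard columns form a basis of V^(tensor d) over
    A^(tensor d), with coordinates [coef r]; [emxten s r] embeds A^(tensor d)
    into M_n(A)^(tensor d) as the multiples of the matrix unit at (s, r). *)
Definition bcol (r : 'I_n) (x : A) : V := \matrix_(i, _) if i == r then x else 0.
Definition bten (r : {ffun 'I_d -> 'I_n}) : tpow d V := tens [ffun a => bcol (r a) 1].
Definition coef (r : {ffun 'I_d -> 'I_n}) : tpow d V -> talg d A :=
  tmap (fun a (u : V) => u (r a) ord0).
Definition emx (s r : 'I_n) (x : A) : Msuper A n :=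
  (\matrix_(i, j) if (i == s) && (j == r) then x else 0) : 'M[A]_n.
Definition emxten (s r : {ffun 'I_d -> 'I_n}) : talg d A -> T :=
  tmap (fun a => emx (s a) (r a)).

Lemma homog_bcol r (x : A) : homog false x -> homog false (bcol r x).
Proof.
move=> hx; apply/smx_homogP=> i j; rewrite mxE; case: ifP => // _.
by rewrite /homog linear0.
Qed.

Lemma scalr_bcol r (x y : A) : scalr (bcol r x) y = bcol r (x * y).
Proof. by apply/matrixP=> i j; rewrite !mxE; case: ifP; rewrite ?mul0r. Qed.

Lemma bcol_sum (u : V) : u = \sum_r bcol r (u r ord0).
Proof.
apply/matrixP=> i j; rewrite summxE (bigD1 i) //= big1 => [|r /negbTE ne].
  by rewrite mxE eqxx addr0 (ord1 j).
by rewrite mxE eq_sym ne.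
Qed.

Lemma entry_linear (r : 'I_n) : linear (fun u : V => u r ord0 : A).
Proof. by move=> c u v; rewrite !(mxE, smxZE). Qed.

Lemma emx_linear s r : linear (emx s r).
Proof.
move=> c x x'; apply/matrixP=> i j; rewrite !mxE.
by case: ifP => _; rewrite ?scaler0 ?addr0.
Qed.

Lemma coef_linear r : linear (coef r).
Proof. by apply: tmap_linear => a; apply: entry_linear. Qed.

Lemma coef_tens r (x : {ffun 'I_d -> V}) :
  coef r (tens x) = tens [ffun a => x a (r a) ord0].
Proof. by apply: tmap_tens => a; apply: entry_linear. Qed.

Lemma emxten_linear s r : linear (emxten s r).
Proof. by apply: tmap_linear => a; apply: emx_linear. Qed.

Lemma emxten_tens s r (x : {ffun 'I_d -> A}) :
  emxten s r (tens x) = tens [ffun a => emx (s a) (r a) (x a)].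
Proof. by apply: tmap_tens => a; apply: emx_linear. Qed.

Lemma bten_even (r : {ffun 'I_d -> 'I_n}) a :
  homog false ([ffun a => bcol (r a) 1] a : V).
Proof. by rewrite ffunE; apply/homog_bcol/homog1. Qed.

Lemma bten_coef v : v = \sum_(r : {ffun 'I_d -> 'I_n}) tscal (bten r) (coef r v).
Proof.
move: v; apply: tens_ext => [||x]; first exact: lin_id.
  by apply: lin_sumf => r; apply: (linear_comp (tscal_linr _) (coef_linear r)).
have {1}-> : x = [ffun a => \sum_r bcol r (x a r ord0)].
  by apply/ffunP=> a; rewrite ffunE -bcol_sum.
rewrite (tens_expand (fun a r => bcol r (x a r ord0))); apply: eq_bigr => r _.
rewrite coef_tens (tscal_evenl _ (@bten_even r)); congr tens.
by apply/ffunP=> a; rewrite !ffunE scalr_bcol mul1r.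
Qed.

Lemma emx_sum (x : Msuper A n) : x = \sum_(j : 'I_n * 'I_n) emx j.1 j.2 ((x : 'M[A]_n) j.1 j.2).
Proof.
apply/matrixP=> i j; rewrite summxE (bigD1 (i, j)) //= big1 => [|[s r] /=].
  by rewrite mxE !eqxx addr0.
by rewrite xpair_eqE mxE [s == _]eq_sym [r == _]eq_sym => /negbTE ->.
Qed.

(** An element of M_n(A)^(tensor d) is recovered from the coordinates of the
    images of the basis vectors; this makes its action on V^(tensor d)
    faithful. *)
Lemma emxten_coef y : y = \sum_(r : {ffun 'I_d -> 'I_n})
  \sum_(s : {ffun 'I_d -> 'I_n}) emxten s r (coef s (left_act y (bten r))).
Proof.
move: y; apply: tens_ext => [||x]; first exact: lin_id.
  do 2![apply: lin_sumf => ?]; apply: (linear_comp (emxten_linear _ _)).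
  exact: (linear_comp (coef_linear _) (left_act_linl _)).
have {1}-> : x = [ffun a => \sum_(j : 'I_n * 'I_n) emx j.1 j.2 ((x a : 'M[A]_n) j.1 j.2)].
  by apply/ffunP=> a; rewrite ffunE -emx_sum.
rewrite (tens_expand (fun a j => emx j.1 j.2 ((x a : 'M[A]_n) j.1 j.2))) pair_big /=.
pose f (u : {ffun 'I_d -> 'I_n} * {ffun 'I_d -> 'I_n}) : {ffun 'I_d -> 'I_n * 'I_n} :=
  [ffun a => (u.2 a, u.1 a)].
pose f' (p : {ffun 'I_d -> 'I_n * 'I_n}) : {ffun 'I_d -> 'I_n} * {ffun 'I_d -> 'I_n} :=
  ([ffun a => (p a).2], [ffun a => (p a).1]).
rewrite (reindex f); last first.
  exists f' => [[r s] _|p _]; first by congr pair; apply/ffunP=> a; rewrite !ffunE.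
  by apply/ffunP=> a; rewrite !ffunE -surjective_pairing.
apply: eq_bigr => -[r s] _ /=.
have -> : left_act (tens x) (bten r) = _ :=
  stbil_evenr sm_linl sm_linr x (@bten_even r).
rewrite coef_tens emxten_tens; congr tens; apply/ffunP=> a; rewrite !ffunE /=.
congr emx; rewrite mxE (bigD1 (r a)) //= big1 => [|i /negbTE ne].
  by rewrite !mxE eqxx mulr1 addr0.
by rewrite !mxE ne mulr0.
Qed.

Lemma left_act_emxten s r r' z :
  left_act (emxten s r z) (bten r') = if r == r' then tscal (bten s) z else 0.
Proof.
move: z; apply: tens_ext => [||x].
- exact: (linear_comp (left_act_linl _) (emxten_linear _ _)).
- case: (r == r'); first exact: tscal_linr.
  by move=> c u v; rewrite scaler0 addr0.
rewrite emxten_tens.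
have -> : left_act (tens _) (bten r') = _ :=
  stbil_evenr sm_linl sm_linr _ (@bten_even r').
case: eqVneq => [<-|ne].
  rewrite (tscal_evenl _ (@bten_even s)); congr tens; apply/ffunP=> a.
  rewrite !ffunE scalr_bcol mul1r; apply/matrixP=> i j.
  rewrite mxE (bigD1 (r a)) //= big1 => [|l /negbTE ne]; last by rewrite !mxE ne andbF mul0r.
  by rewrite !mxE !eqxx andbT mulr1 addr0.
have [a ra] := ffun_neqP ne.
rewrite (tens_eq0 (a := a)) // !ffunE; apply/matrixP=> i j.
rewrite !mxE big1 // => l _; rewrite !mxE.
case: (eqVneq l (r a)) => [->|_]; last by rewrite andbF mul0r.
by rewrite (negbTE ra) mulr0.
Qed.

Lemma left_act_inj y y' : (forall v, left_act y v = left_act y' v) -> y = y'.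
Proof.
move=> h; rewrite [y]emxten_coef [y']emxten_coef.
by do 2![apply: eq_bigr => ? _]; rewrite h.
Qed.

(** The element y is the matrix of F; it is invariant because F commutes with
    permutations and the action is faithful. *)
Lemma right_linear_left_act (F : tpow d V -> tpow d V) : linear F ->
  (forall v w, F (right_act v w) = right_act (F v) w) ->
  exists y, Defs.invariant y /\ forall v, left_act y v = F v.
Proof.
move=> lF FR; pose y : T := \sum_(r : {ffun 'I_d -> 'I_n})
  \sum_(s : {ffun 'I_d -> 'I_n}) emxten s r (coef s (F (bten r))).
have Fx v x : F (tscal v x) = tscal (F v) x by rewrite -!right_act_winc FR.
have yF v : left_act y v = F v.
  rewrite [v in LHS]bten_coef [v in RHS]bten_coef (lin_sum (left_act_linr y)) (lin_sum lF).
  apply: eq_bigr => r _; rewrite left_act_tscal Fx; congr tscal.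
  rewrite [RHS]bten_coef /y left_act_suml (bigD1 r) //=.
  rewrite [X in _ + X]big1 => [|r' /negbTE ne].
    rewrite addr0 left_act_suml; apply: eq_bigr => s _.
    by rewrite left_act_emxten eqxx.
  by rewrite left_act_suml big1 // => s _; rewrite left_act_emxten ne.
exists y; split=> //; apply/forallP=> g; apply/eqP/left_act_inj => v.
have Fg u : F (pact g u) = pact g (F u).
  by have := FR u (wtens 1 g); rewrite !right_act_wtens !tscal1.
rewrite -[v in LHS]pact1 -(mulgV g) -pactM -pact_left_act !yF -Fg pactM.
by rewrite mulgV pact1.
Qed.

End Actions.

(** * Coloured compositions and Young subgroups *)

Lemma pairwise_flatten_nseq (T : eqType) (r : rel T) (m : T -> nat) (s : seq T) :
  reflexive r -> pairwise r s -> pairwise r (flatten [seq nseq (m x) x | x <- s]).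
Proof.
move=> rr; elim: s => //= x s IH /andP[/allP xs /IH ps].
rewrite pairwise_cat ps andbT; apply/andP; split.
  apply/allrelP => y z /nseqP[-> _] /flattenP[t /mapP[u us ->] /nseqP[-> _]].
  exact: xs.
by elim: (m x) => //= i ->; rewrite andbT; apply/allP => y /nseqP[->].
Qed.

Section ColoredCompositions.
Variables (n l d : nat).
Local Notation X := ('I_n * 'I_l)%type.
Implicit Types (lam mu : ccomp n l d) (g h : 'S_d).
Implicit Types (x : X) (a b : 'I_d).

Definition lex : seq X := [seq (r, i) | r <- enum 'I_n, i <- enum 'I_l].

Lemma mem_lex x : x \in lex.
Proof. by case: x => r i; apply: allpairs_f; rewrite mem_enum. Qed.

Lemma lex_uniq : uniq lex.
Proof. by apply: allpairs_uniq; rewrite ?enum_uniq // => -[? ?] [? ?] _ _ [-> ->]. Qed.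

Lemma count_color lam x : count_mem x (color_seq lam) = val lam x.
Proof.
rewrite /color_seq count_flatten -map_comp sumnE big_map.
rewrite (bigD1_seq x (mem_lex x) lex_uniq) /= count_nseq /= eqxx mul1n.
by rewrite big1 ?addn0 // => y /negbTE ne; rewrite /= count_nseq /= ne mul0n.
Qed.

Lemma card_color lam x : #|[set a | tnth (color lam) a == x]| = val lam x.
Proof.
rewrite -count_color -[color_seq lam]/(val (color lam)).
rewrite -[X in count_mem _ X](map_tnth_enum (color lam)).
by rewrite count_map -sum1_card -sum1_count big_enum_cond /=; apply: eq_bigl => a; rewrite inE.
Qed.

(** The parts of a composition are the sizes of the classes of its colouring, and
    permutations preserve these. *)
Lemma color_perm_inj lam mu g h :
  (forall a, tnth (color lam) (g a) = tnth (color mu) (h a)) -> lam = mu.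
Proof.
have E nu f x : #|[set a | tnth (color nu) ((f : 'S_d) a) == x]| = val nu x.
  rewrite -card_color -(card_preimset [set a | tnth (color nu) a == x] (@perm_inj _ f)).
  by apply: eq_card => a; rewrite !inE.
move=> e; apply/val_inj/ffunP=> x; apply/val_inj; rewrite /= -(E lam g) -(E mu h).
by apply: eq_card => a; rewrite !inE e.
Qed.

(** The composition formed by the sizes of the colour classes works, as sequences
    with equal multiplicities are permutations of each other. *)
Lemma color_perm_ex (c : {ffun 'I_d -> X}) :
  exists u : ccomp n l d * 'S_d, forall a, tnth (color u.1) (u.2 a) = c a.
Proof.
have lt x : (#|[set a | c a == x]| < d.+1)%N.
  by rewrite ltnS -[X in (_ <= X)%N]card_ord max_card.
pose mu0 : {ffun X -> 'I_d.+1} := [ffun x => Ordinal (lt x)].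
have mu0P : \sum_x (mu0 x : nat) == d.
  apply/eqP; rewrite -[RHS]card_ord -sum1_card (partition_big c xpredT) //=.
  by apply: eq_bigr => x _; rewrite ffunE /= sum1dep_card; apply: eq_card => a; rewrite !inE.
pose mu : ccomp n l d := Sub mu0 mu0P.
pose t : d.-tuple X := [tuple c a | a < d].
have : perm_eq t (color mu).
  apply/allP => x _ /=; rewrite count_color /= ffunE /= count_map.
  rewrite -sum1_card -sum1_count big_enum_cond /=.
  by apply/eqP; apply: eq_bigl => a; rewrite !inE.
case/tuple_permP => g e; exists (mu, g) => a /=.
have := congr1 (fun s => nth (c a) s a) e.
by rewrite /= !nth_mktuple.
Qed.

Definition rank x := index x lex.

Lemma rank_inj : injective rank.
Proof.
move=> x y e; rewrite -[x](nth_index x (mem_lex x)) -/(rank x) e.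
by rewrite nth_index ?mem_lex.
Qed.

Lemma rank_color lam a b : (a <= b)%N ->
  (rank (tnth (color lam) a) <= rank (tnth (color lam) b))%N.
Proof.
rewrite leq_eqVlt => /orP[/eqP/val_inj ->//|ab].
have pw : pairwise (relpre rank leq) lex.
  case E : lex => [//|x0 s]; rewrite -E; apply/(pairwiseP x0) => i j.
  by rewrite !inE /= => li lj ij; rewrite /rank !index_uniq ?lex_uniq // ltnW.
have := pairwise_flatten_nseq (fun x => val lam x) (fun x => leqnn (rank x)) pw.
move/(pairwiseP (tnth (color lam) a)) => /(_ a b).
rewrite -[flatten _]/(val (color lam)) !inE size_tuple !ltn_ord => /(_ isT isT ab).
have E (x0 : X) (b' : 'I_d) : nth x0 (val (color lam)) b' = tnth (color lam) b'.
  by rewrite (tnth_nth x0).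
by rewrite /= !E.
Qed.

Lemma young_restr lam g x a : in_young lam g ->
  restr_perm (segment lam x) g a = if tnth (color lam) a == x then g a else a.
Proof.
move/forallP => yg; have sg : g \in ('N(segment lam x | 'P))%g.
  by rewrite inE in_setT inE /=; apply/subsetP => b; rewrite !inE /= apermE (eqP (yg b)).
case: ifP => e; first by rewrite restr_permE // inE e.
by apply: (out_perm (restr_perm_on _ _)); rewrite inE e.
Qed.

(** Inversions of an element of the Young subgroup occur inside segments only,
    and those in a segment of odd colour are counted by both sides. *)
Lemma young_sign_sgnp (k : comPzRingType) (par : 'I_l -> bool) lam g : in_young lam g ->
  young_sign k par lam g = (-1) ^+ sgnp g [ffun a => par (tnth (color lam) a).2].
Proof.
move=> yg; set p := [ffun a => _]; pose c := tnth (color lam).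
have cg a : c (g a) = c a by have /forallP/(_ a)/eqP := yg.
rewrite -sgnpV; have -> : [ffun a => p (g a)] = p.
  by apply/ffunP=> a; rewrite !ffunE -!/(c _) cg.
pose inv (u : 'I_d * 'I_d) := (u.1 < u.2)%N && (g u.2 < g u.1)%N.
(* An inversion of g stays within one segment, as colours weakly increase. *)
have invc u : inv u -> c u.1 = c u.2.
  case/andP => /ltnW u12 /ltnW gu; apply/rank_inj/eqP; rewrite eqn_leq.
  by rewrite rank_color //= -[c u.1]cg -[c u.2]cg rank_color.
rewrite /sgnp (eq_bigl inv) => [|u]; last by rewrite invgK.
rewrite (big_morph (fun b : bool => (-1) ^+ b : k) (@signr_addb k) (erefl _)).
rewrite (partition_big (fun u => c u.1) xpredT) //=; apply: eq_bigr => x _.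
rewrite (eq_bigr (fun=> if par x.2 then -1 else 1)) => [|u /andP[iu /eqP e]]; last first.
  by rewrite !ffunE -!/(c _) -(invc _ iu) e; case: (par x.2).
rewrite prodr_const; congr (_ ^+ _); rewrite /perm_length cardsE.
apply: eq_card => -[a b]; rewrite !unfold_in /=.
rewrite !young_restr //= /inv /= -/(c a) -/(c b).
have mid (e f h : 'I_d) : (e <= f)%N -> (f <= h)%N -> c e = c h -> c f = c e.
  move=> ef fh eh; apply/rank_inj/eqP; rewrite eqn_leq {1}eh.
  by rewrite !rank_color.
case: (eqVneq (c a) x) => ax; case: (eqVneq (c b) x) => bx //=; rewrite ?andbT ?andbF //.
- apply/andP/idP => [[ab ba]|/(invc (a, b)) /= ab]; last by rewrite -ab ax eqxx in bx.
  by case/eqP: bx; rewrite -ax; apply: (mid a b (g a)); rewrite ?cg // ltnW.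
- apply/negbTE/negP => /andP[ab ba]; case/eqP: ax; rewrite -bx -[c b]cg.
  by apply: (mid (g b) a b); rewrite ?cg // ltnW.
- by apply/negbTE/negP => /andP[ab /(ltn_trans ab)]; rewrite ltnn.
Qed.

End ColoredCompositions.

(** * Permutation modules and tensor space *)

Section WModule.
Variables (k : comPzRingType) (d : nat) (B : superalg k) (M : wmodule d B).

Lemma wend_sum (I : Type) (r : seq I) (P : pred I) (F : I -> M) (f : wend M) :
  f (\sum_(i <- r | P i) F i) = \sum_(i <- r | P i) f (F i).
Proof. exact: (lin_sum (wend_linear f)). Qed.

End WModule.

Section PermutationModules.
Variables (k : comPzRingType) (A : superalg k) (l n d : nat).
Variables (eps : bool -> A) (par : 'I_l -> bool) (e : 'I_l -> A).
Hypothesis eps_adapted : adapted_pair eps.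
Hypothesis e_orth : forall i j, par i = par j -> e i * e j = if i == j then e i else 0.
Hypothesis e_sum : forall b, eps b = \sum_(i | par i == b) e i.
Local Notation U := (ungraded A).
Local Notation V := (smx A n 1).
Local Notation W := (wreath d A).
Local Notation W' := (wreath d U).
Local Notation Lambda := (ccomp n l d).
Local Notation X := ('I_n * 'I_l)%type.
Implicit Types (mu nu : Lambda) (g h : 'S_d).

Lemma e_idem i : e i * e i = e i.
Proof. by rewrite e_orth // eqxx. Qed.

Lemma e_eps i b : e i * eps b = if par i == b then e i else 0.
Proof.
have E : e i * eps (par i) = e i.
  rewrite e_sum mulr_sumr (bigD1 i) //= e_idem big1 ?addr0 // => j /andP[/eqP pj ne].
  by rewrite e_orth ?pj // eq_sym (negbTE ne).
by rewrite -{1}E -mulrA (epsM eps_adapted); case: eqP => _; rewrite ?mulr0.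
Qed.

Lemma eps_e i b : eps b * e i = if par i == b then e i else 0.
Proof.
have E : eps (par i) * e i = e i.
  rewrite e_sum mulr_suml (bigD1 i) //= e_idem big1 ?addr0 // => j /andP[/eqP pj ne].
  by rewrite e_orth ?pj // (negbTE ne).
rewrite -{1}E mulrA (epsM eps_adapted) [par i == b]eq_sym.
by case: eqP => [->|_]; rewrite ?mul0r.
Qed.

Lemma eM i j : e i * e j = if i == j then e i else 0.
Proof.
case: (eqVneq (par i) (par j)) => [/e_orth//|ne].
have -> : e i * e j = e i * eps (par i) * e j by rewrite e_eps eqxx.
rewrite -mulrA eps_e eq_sym (negbTE ne) mulr0.
by case: (eqVneq i j) ne => [->|//]; rewrite eqxx.
Qed.

Lemma sum_e : \sum_i e i = 1.
Proof.
rewrite -(eps_sum eps_adapted) (partition_big par xpredT) //=.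
by apply: eq_bigr => b _; rewrite e_sum.
Qed.

Lemma e_corner i : corner eps (par i) (par i) (e i) = e i.
Proof. by rewrite /corner eps_e eqxx e_eps eqxx. Qed.

Lemma e_even i : homog false (e i).
Proof. by rewrite -e_corner -(addbb (par i)); apply: homog_corner. Qed.

(** The elements e_la and v_la depend on la through its colouring only, and make
    sense for every colouring of the places. *)
Definition etens (c : {ffun 'I_d -> X}) : talg d A := tens [ffun a => e (c a).2].
Definition vtens (c : {ffun 'I_d -> X}) : tpow d V :=
  tens [ffun a => bcol (c a).1 (e (c a).2)].
Definition colors mu : {ffun 'I_d -> X} := [ffun a => tnth (color mu) a].
Definition pcolors mu g : {ffun 'I_d -> X} := [ffun a => tnth (color mu) (g a)].

Lemma e_lamE mu : e_lam e mu = etens (colors mu).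
Proof. by congr tens; apply/ffunP=> a; rewrite !ffunE. Qed.

Lemma v_lamE mu : v_lam e mu = vtens (colors mu).
Proof. by congr tens; apply/ffunP=> a; rewrite !ffunE. Qed.

Lemma etens_even (c : {ffun 'I_d -> X}) a : homog false ([ffun a => e (c a).2] a : A).
Proof. by rewrite ffunE; apply: e_even. Qed.

Lemma vtens_even (c : {ffun 'I_d -> X}) a :
  homog false ([ffun a => bcol (c a).1 (e (c a).2)] a : V).
Proof. by rewrite ffunE; apply/homog_bcol/e_even. Qed.

Lemma pact_etens g c : pact g (etens c) = etens [ffun a => c (g a)].
Proof.
by rewrite (pact_even _ (@etens_even c)); congr tens; apply/ffunP=> a; rewrite !ffunE.
Qed.

Lemma pact_vtens g c : pact g (vtens c) = vtens [ffun a => c (g a)].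
Proof.
by rewrite (pact_even _ (@vtens_even c)); congr tens; apply/ffunP=> a; rewrite !ffunE.
Qed.

Lemma vtens_etens c : tscal (vtens c) (etens c) = vtens c.
Proof.
rewrite (tscal_evenl _ (@vtens_even c)); congr tens; apply/ffunP=> a.
by rewrite !ffunE scalr_bcol e_idem.
Qed.

Lemma colors_pact mu g : [ffun a => colors mu (g a)] = pcolors mu g.
Proof. by apply/ffunP=> a; rewrite !ffunE. Qed.

Lemma young_colors mu g : in_young mu g -> [ffun a => colors mu (g a)] = colors mu.
Proof. by move/forallP=> yg; apply/ffunP=> a; rewrite !ffunE (eqP (yg a)). Qed.

Lemma in_youngV mu g : in_young mu g -> in_young mu g^-1%g.
Proof.
by move/forallP=> yg; apply/forallP=> a; rewrite eq_sym -(eqP (yg (g^-1%g a))) permKV.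
Qed.

Lemma v_lam_act mu g (y : {ffun 'I_d -> A}) :
  right_act (v_lam e mu) (wtens 1 g * winc (tens y)) =
  tens [ffun a => bcol (pcolors mu g a).1 (e (pcolors mu g a).2 * y a)].
Proof.
rewrite -right_actM right_act_wtens tscal1 right_act_winc v_lamE pact_vtens colors_pact.
rewrite (tscal_evenl _ (@vtens_even _)); congr tens; apply/ffunP=> a.
by rewrite !ffunE scalr_bcol.
Qed.

Lemma young_sign_sqr mu g : in_young mu g ->
  young_sign k par mu g * young_sign k par mu g = 1.
Proof. by move=> yg; rewrite young_sign_sgnp // -expr2 sqrr_sign. Qed.

(** e_la is the corner tensor for the parities p of the colours, so that sigma
    fixes it and D_g acts on it by the sign of g on p. *)
Lemma sigma_map_e_lam mu g : in_young mu g ->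
  sigma_map eps (wtens (e_lam e mu) g) = young_sign k par mu g *: (wtens (etens (colors mu)) g : W).
Proof.
move=> yg; rewrite -e_lamE sigma_map_wtens young_sign_sgnp //; set p := [ffun a => _].
have ce : cornered eps p p [ffun a => e (tnth (color mu) a).2].
  by move=> a; rewrite !ffunE e_corner.
rewrite [twist eps _](twist_cornered eps_adapted ce) -talgZl (perm_signMr eps_adapted _ ce).
have -> : [ffun a => p a (+) p a] = [ffun=> false].
  by apply/ffunP=> a; rewrite !ffunE addbb.
rewrite sgn2_0l scale1r; exact: (linearZ_of _ _ (@wtens_linear _ _ _ g)).
Qed.

Lemma v_lam_young mu g : in_young mu g ->
  right_act (v_lam e mu) (wtens (etens (colors mu)) g) = v_lam e mu.
Proof.
move=> yg; rewrite right_act_wtens v_lamE vtens_etens pact_vtens.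
by rewrite young_colors.
Qed.

Lemma pmod_gen_young mu g : in_young mu g ->
  wm_act (pmod_gen par e mu) (wtens (e_lam e mu) g) =
  young_sign k par mu g *: pmod_gen par e mu.
Proof.
move=> yg; have [h1 h2 h3] := pmod_tens_balanced par e mu.
have := h3 g yg 1 (eW_gen e mu); rewrite mul1r => E.
have := h1 (eW_gen e mu) (young_sign k par mu g) 1 0.
rewrite addr0 [_ *: (1 : k^o)]mulr1 E.
have -> : pmod_tens par 0 (eW_gen e mu) = 0 by apply: (lin0 (h1 _)).
rewrite addr0 /= => <-; rewrite [LHS]pmod_act_tens; congr pmod_tens; apply: val_inj => /=.
have ee : e_lam e mu * e_lam e mu = e_lam e mu.
  by rewrite [LHS]ug_tensM; congr tens; apply/ffunP=> a; rewrite !ffunE; apply: e_idem.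
rewrite !wtensM invg1 pact1 mul1g mulg1 ee; congr wtens.
have -> : pact g^-1%g (e_lam e mu) = e_lam e mu; last by rewrite ee.
rewrite [LHS]ug_pact; congr tens; apply/ffunP=> a; rewrite !ffunE.
by have /forallP/(_ a)/eqP-> := in_youngV yg.
Qed.

(** An element of the tensor product is a sum of terms b (x) e_la w, and each
    of these is the generator times b w. *)
Lemma pmod_cyclic mu (m : pmod par e mu) : exists u : W', m = wm_act (pmod_gen par e mu) u.
Proof.
rewrite [m]umodE /fsum; elim: (generic_quotient.repr m) => [|[c [b x]] s [u us]].
  by exists 0; rewrite big_nil (lin0 (@wm_actr _ _ _ _ _)).
rewrite big_cons {}us -[(c, (b, x)).1]/c -[(c, (b, x)).2]/(b, x).
have [h1 h2 h3] := pmod_tens_balanced par e mu.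
have [w xw] : exists w, x = eW_right (eW_gen e mu) w.
  by case: x => x px; case/asboolP: (px) => w xw; exists w; apply: val_inj.
exists (c *: (b *: w) + u); rewrite wm_actr; congr (_ *: _ + _).
rewrite (linearZ_of _ _ (@wm_actr _ _ _ _ _)).
have := h1 x b 1 0; rewrite addr0 [_ *: (1 : k^o)]mulr1.
have -> : pmod_tens par 0 x = 0 by apply: (lin0 (h1 _)).
by rewrite addr0 -[uin _ _]/(pmod_tens par b x) => ->; rewrite [wm_act _ _]pmod_act_tens xw.
Qed.

Local Notation M := (Mnd n d par e).

Lemma m_lam_act mu (w : W') nu :
  wm_act (m_lam par e mu) w nu = if nu == mu then wm_act (pmod_gen par e nu) w else 0.
Proof.
rewrite /= /m_lam; case: eqP => // _.
exact: (lin0 (@wm_actl _ _ _ (pmod par e nu) w)).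
Qed.

Lemma Mnd_sumE (I : Type) (r : seq I) (F : I -> M) nu :
  (\sum_(i <- r) F i : M) nu = \sum_(i <- r) F i nu.
Proof. by apply: (lin_sum (f := fun m : M => m nu)). Qed.

Lemma Mnd_gen (m : M) : exists u : Lambda -> W', m = \sum_mu wm_act (m_lam par e mu) (u mu).
Proof.
have /choice[u mu_u] nu := pmod_cyclic (m nu).
exists u; apply: functional_extensionality_dep => nu; rewrite Mnd_sumE.
rewrite (bigD1 nu) // m_lam_act eqxx -mu_u big1 => [|mu ne]; first by rewrite /= addr0.
by rewrite m_lam_act eq_sym (negbTE ne).
Qed.

(** The component at mu of the bijection from M^|A|(n, d) to tensor space,
    sending m_mu w to v_mu sigma(w). *)
Definition pmod_to_Vd mu : pmod par e mu -> tpow d V :=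
  ulift (fun u : k * eW e mu => u.1 *: right_act (v_lam e mu) (sigma_map eps (eW_val u.2))).

Lemma pmod_to_Vd_balanced mu : balanced par
  (fun u : k * eW e mu => u.1 *: right_act (v_lam e mu) (sigma_map eps (eW_val u.2))).
Proof.
have [sM1 sM] := sigma_map_monoid d eps_adapted; split=> [x c u v|c b x y|g yg c x] /=.
- by rewrite scalerDl scalerA.
- rewrite sigma_map_linear right_act_linr scalerDr !scalerA [c * b]mulrC //.
- rewrite sM -right_actM sigma_map_e_lam // (linearZ_of _ _ (right_act_linr _)).
  rewrite v_lam_young // (linearZ_of _ _ (right_act_linl _)) scalerA //.
Qed.

Lemma pmod_to_Vd_linear mu : linear (@pmod_to_Vd mu).
Proof. exact/ulift_linear/pmod_to_Vd_balanced. Qed.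

Lemma pmod_to_Vd_gen mu (w : W') :
  pmod_to_Vd (wm_act (pmod_gen par e mu) w) = right_act (v_lam e mu) (sigma_map eps w).
Proof.
have [sM1 sM] := sigma_map_monoid d eps_adapted.
rewrite [wm_act _ _]pmod_act_tens [LHS](ulift_uin _ (@pmod_to_Vd_balanced mu)) /= scale1r.
rewrite sM -right_actM; have y1 : in_young mu 1%g by apply/forallP=> a; rewrite perm1.
have := sigma_map_e_lam y1; rewrite young_sign_sgnp // sgnp1 scale1r => ->.
by rewrite v_lam_young.
Qed.

Definition Mnd_to_Vd (m : M) : tpow d V := \sum_mu pmod_to_Vd (m mu).

Lemma Mnd_to_Vd_linear : linear Mnd_to_Vd.
Proof.
move=> c x y; rewrite /Mnd_to_Vd scaler_sumr -big_split /=; apply: eq_bigr => mu _.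
exact: pmod_to_Vd_linear.
Qed.

Lemma Mnd_to_Vd_m_lam mu (w : W') :
  Mnd_to_Vd (wm_act (m_lam par e mu) w) = right_act (v_lam e mu) (sigma_map eps w).
Proof.
rewrite /Mnd_to_Vd (bigD1 mu) // m_lam_act eqxx pmod_to_Vd_gen.
rewrite big1 => [|nu ne]; first by rewrite /= addr0.
by rewrite m_lam_act (negbTE ne) (lin0 (@pmod_to_Vd_linear nu)).
Qed.

Lemma Mnd_to_Vd_act (m : M) (w : W') :
  Mnd_to_Vd (wm_act m w) = right_act (Mnd_to_Vd m) (sigma_map eps w).
Proof.
have [sM1 sM] := sigma_map_monoid d eps_adapted; have [u ->] := Mnd_gen m.
rewrite (lin_sum (f := fun m : M => wm_act m w)) ?(lin_sum Mnd_to_Vd_linear) ?right_act_suml //.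
  by apply: eq_bigr => mu _; rewrite -wm_actM !Mnd_to_Vd_m_lam sM right_actM.
exact: wm_actl.
Qed.

Section Inverse.
Variable sigma' : W -> W'.
Hypothesis sigmaK : cancel (@sigma_map k d A eps) sigma'.
Hypothesis sigmaKV : cancel sigma' (@sigma_map k d A eps).

Lemma sigma'_linear : linear sigma'.
Proof.
by move=> c x y; apply: (can_inj sigmaK); rewrite sigma_map_linear !sigmaKV.
Qed.

Lemma sigma'M (x y : W) : sigma' (x * y) = sigma' x * sigma' y.
Proof.
have [_ sM] := sigma_map_monoid d eps_adapted.
by apply: (can_inj sigmaK); rewrite sM !sigmaKV.
Qed.

Definition pick_color (c : {ffun 'I_d -> X}) : Lambda * 'S_d :=
  sval (cid (color_perm_ex c)).

Lemma pick_colorE c : pcolors (pick_color c).1 (pick_color c).2 = c.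
Proof.
apply/ffunP=> a; rewrite ffunE /pick_color.
by case: (cid _) => u /= ->.
Qed.

(** The coefficients of the component at c in the decomposition of V^(tensor d)
    into the v_c A^(tensor d). *)
Definition ecoef (c : {ffun 'I_d -> X}) : tpow d V -> talg d A :=
  tmap (fun a (u : V) => e (c a).2 * u (c a).1 ord0).

Lemma ecoef_lin (c : {ffun 'I_d -> X}) a :
  linear (fun u : V => e (c a).2 * u (c a).1 ord0).
Proof. exact: (linear_comp (saMr _) (entry_linear _)). Qed.

(** As v_c = v_mu g for the composition mu and the permutation g chosen for c,
    the component v_c x at c must be sent to m_mu sigma^-1(g x). *)
Definition Vd_to_Mnd (v : tpow d V) : M :=
  \sum_(c : {ffun 'I_d -> X})
    wm_act (m_lam par e (pick_color c).1)
      (sigma' (wtens 1 (pick_color c).2 * winc (ecoef c v))).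

Lemma Vd_to_Mnd_linear : linear Vd_to_Mnd.
Proof.
apply: lin_sumf => c; apply: (linear_comp (@wm_actr _ _ _ M _)).
apply: (linear_comp sigma'_linear) => b u v.
by rewrite /ecoef (tmap_linear (ecoef_lin c)) winc_linear mulrDr wreathZr.
Qed.

Lemma Vd_to_MndK : cancel Vd_to_Mnd Mnd_to_Vd.
Proof.
apply: tens_ext => [||x]; [exact: (linear_comp Mnd_to_Vd_linear Vd_to_Mnd_linear)|exact: lin_id|].
rewrite /Vd_to_Mnd (lin_sum Mnd_to_Vd_linear).
have xE : x = [ffun a => \sum_(j : X) bcol j.1 (e j.2 * x a j.1 ord0)].
  apply/ffunP=> a; rewrite ffunE {1}[x a]bcol_sum.
  rewrite -(pair_bigA _ (fun r i => bcol r (e i * x a r ord0))) /=.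
  apply: eq_bigr => r _; apply/matrixP=> s t; rewrite summxE mxE.
  under eq_bigr do rewrite mxE.
  case: ifP => _; last by rewrite big1.
  by rewrite -mulr_suml sum_e mul1r.
rewrite [in RHS]xE (tens_expand (fun a j => bcol j.1 (e j.2 * x a j.1 ord0))).
apply: eq_bigr => c _; rewrite Mnd_to_Vd_m_lam sigmaKV /ecoef (tmap_tens (ecoef_lin c)).
rewrite v_lam_act pick_colorE; congr tens; apply/ffunP=> a; rewrite !ffunE.
by rewrite mulrA e_idem.
Qed.

(** The sign of sigma^-1(e_la (x) g) cancels the one by which e_la (x) g acts
    on m_la. *)
Lemma m_lam_young mu g : in_young mu g ->
  wm_act (m_lam par e mu) (sigma' (wtens (etens (colors mu)) g)) = m_lam par e mu.
Proof.
move=> yg; have E : sigma' (wtens (etens (colors mu)) g) =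
    young_sign k par mu g *: (wtens (e_lam e mu) g : W').
  apply: (can_inj sigmaK); rewrite sigmaKV (linearZ_of _ _ (@sigma_map_linear k d A eps)).
  by rewrite sigma_map_e_lam // scalerA young_sign_sqr // scale1r.
apply: functional_extensionality_dep => nu; rewrite m_lam_act E /m_lam.
case: (eqVneq nu mu) => [->|//].
rewrite (linearZ_of _ _ (@wm_actr _ _ _ _ _)) pmod_gen_young //.
by rewrite scalerA young_sign_sqr // scale1r.
Qed.

(** Permutations giving the same colouring differ by an element of the Young
    subgroup; hence the choice made for each colouring is immaterial. *)
Lemma m_lam_perm mu g h : pcolors mu g = pcolors mu h ->
  wm_act (m_lam par e mu) (sigma' (wtens (etens (colors mu)) g)) =
  wm_act (m_lam par e mu) (sigma' (wtens (etens (colors mu)) h)).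
Proof.
move=> gh; have yf : in_young mu (h^-1 * g)%g.
  apply/forallP=> a; rewrite permM; apply/eqP.
  by move/ffunP/(_ (h^-1%g a)): gh; rewrite !ffunE permKV.
have -> : wtens (etens (colors mu)) g = wtens (etens (colors mu)) (h^-1 * g)%g * wtens 1 h :> W.
  by rewrite wtensM pact_one mulr1 mulKVg.
have y1 : in_young mu 1%g by apply/forallP=> a; rewrite perm1.
have -> : wtens (etens (colors mu)) h = wtens (etens (colors mu)) 1%g * wtens 1 h :> W.
  by rewrite wtensM pact_one mulr1 mulg1.
by rewrite !sigma'M !wm_actM !m_lam_young.
Qed.

(** It suffices to treat v_mu g y = v_c y, for c the colouring of mu permuted
    by g.  Only its component at c is nonzero, and the composition chosen for
    c is mu. *)
Lemma Vd_to_Mnd_v_lam mu (w : W) :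
  Vd_to_Mnd (right_act (v_lam e mu) w) = wm_act (m_lam par e mu) (sigma' w).
Proof.
move: w; apply: wreath_ext => [||g y].
- exact: (linear_comp Vd_to_Mnd_linear (right_act_linr _)).
- exact: (linear_comp (@wm_actr _ _ _ M _) sigma'_linear).
pose c := pcolors mu g.
rewrite v_lam_act -/c /Vd_to_Mnd (bigD1 c) // big1 => [|c' ne]; last first.
  have [a ca] := ffun_neqP ne.
  rewrite /ecoef (tmap_tens (ecoef_lin c')) (tens_eq0 (a := a)).
    rewrite (lin0 (@winc_linear _ _ _)) mulr0 (lin0 sigma'_linear).
    exact: (lin0 (@wm_actr _ _ _ M _)).
  rewrite !ffunE mxE; case: eqP => [e1|_]; last by rewrite mulr0.
  rewrite mulrA eM; case: eqP => [e2|_]; last by rewrite mul0r.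
  by case/eqP: ca; rewrite ffunE; case: (c' a) (tnth _ _) e1 e2 => ? ? [? ?] /= -> ->.
apply: (etrans (addr0 _)); rewrite /ecoef (tmap_tens (ecoef_lin c)).
have -> : tens [ffun a => e (c a).2 * [ffun a0 => bcol (c a0).1 (e (c a0).2 * y a0)] a
     (c a).1 ord0] = etens c * tens y :> talg d A.
  rewrite /etens (tensM_evenl _ (@etens_even c)); congr tens; apply/ffunP=> a.
  by rewrite !ffunE mxE eqxx mulrA e_idem.
have pc := pick_colorE c; set nu := (pick_color c).1 in pc *.
set f := (pick_color c).2 in pc *.
have nuE : nu = mu.
  by apply: (color_perm_inj (g := f) (h := g)) => a; move/ffunP/(_ a): pc; rewrite !ffunE.
rewrite nuE in pc *.
have F h : pcolors mu h = c ->
    wtens 1 h * winc (etens c) = wtens (etens (colors mu)) h :> W.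
  move=> hc; rewrite wtens_winc mul1r pact_etens; congr (wtens (etens _) _).
  by apply/ffunP=> a; rewrite -hc !ffunE permKV.
rewrite wincM mulrA F // sigma'M wm_actM (m_lam_perm (h := g)) //.
rewrite -wm_actM -sigma'M -(F g erefl) -mulrA.
rewrite [in RHS]sigma'M wm_actM.
have y1 : in_young mu 1%g by apply/forallP=> a; rewrite perm1.
rewrite -[in RHS](m_lam_young y1) -!wm_actM -!sigma'M; congr (wm_act _ (sigma' _)).
rewrite !mulrA F // [in RHS]wtensM pact_one mulr1 mulg1 //.
Qed.

Lemma Mnd_to_VdK : cancel Mnd_to_Vd Vd_to_Mnd.
Proof.
move=> m; have [u ->] := Mnd_gen m.
rewrite (lin_sum Mnd_to_Vd_linear) (lin_sum Vd_to_Mnd_linear); apply: eq_bigr => mu _.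
by rewrite Mnd_to_Vd_m_lam Vd_to_Mnd_v_lam sigmaK.
Qed.

Lemma Vd_to_Mnd_act (v : tpow d V) (w : W) :
  Vd_to_Mnd (right_act v w) = wm_act (Vd_to_Mnd v) (sigma' w).
Proof. by rewrite -[w in LHS]sigmaKV -{1}[v]Vd_to_MndK -Mnd_to_Vd_act Mnd_to_VdK. Qed.

Lemma v_lam_span (v : tpow d V) :
  exists h : Lambda -> W, v = \sum_mu right_act (v_lam e mu) (h mu).
Proof.
have [u E] := Mnd_gen (Vd_to_Mnd v); exists (fun mu => sigma_map eps (u mu)).
rewrite -{1}[v]Vd_to_MndK E (lin_sum Mnd_to_Vd_linear).
by apply: eq_bigr => mu _; rewrite Mnd_to_Vd_m_lam.
Qed.

(** * The isomorphism psi *)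

Local Notation S := (schur A n d).

Lemma schur_invariant (y : S) : Defs.invariant (y : talg d (Msuper A n)).
Proof. by case: y. Qed.

Definition psi_map (y : S) : wend M.
Proof.
refine (@WEnd _ _ _ M (fun m => Vd_to_Mnd (left_act y (Mnd_to_Vd m))) _ _) => [|m w].
  exact: (linear_comp Vd_to_Mnd_linear (linear_comp (left_act_linr y) Mnd_to_Vd_linear)).
by rewrite Mnd_to_Vd_act (left_right_act _ _ (schur_invariant y)) Vd_to_Mnd_act sigmaK.
Defined.

Lemma psi_map_is_psi : is_psi sigma' psi_map.
Proof.
move=> y lam h hE /=; have [s1 sM] := sigma_map_monoid d eps_adapted.
have -> : Mnd_to_Vd (m_lam par e lam) = v_lam e lam.
  by have := Mnd_to_Vd_m_lam lam 1; rewrite wm_act1 s1 right_act1.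
by rewrite hE (lin_sum Vd_to_Mnd_linear); apply: eq_bigr => mu _; rewrite Vd_to_Mnd_v_lam.
Qed.

(** The m_la generate M^|A|(n, d), and every y v_la has an expansion in the
    v_mu, so that the defining property determines psi. *)
Lemma is_psi_inj psi1 psi2 : is_psi sigma' psi1 -> is_psi sigma' psi2 ->
  psi1 =1 psi2 :> (S -> wend M).
Proof.
move=> h1 h2 y; apply: wendP => m; have [u ->] := Mnd_gen m.
rewrite !wend_sum; apply: eq_bigr => mu _; rewrite !wend_act.
by have [h hE] := v_lam_span (left_act y (v_lam e mu)); rewrite (h1 _ _ _ hE) (h2 _ _ _ hE).
Qed.

Lemma psi_map_alg_iso : is_alg_iso psi_map.
Proof.
split.
- move=> c y y'; apply: wendP => m /=.
  have -> : left_act (c *: y + y') (Mnd_to_Vd m) =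
      c *: left_act y (Mnd_to_Vd m) + left_act y' (Mnd_to_Vd m).
    exact: left_act_linl.
  by rewrite Vd_to_Mnd_linear.
- split=> [|y y']; apply: wendP => m /=.
    have -> : left_act (1 : S) (Mnd_to_Vd m) = Mnd_to_Vd m by exact: left_act1.
    exact: Mnd_to_VdK.
  have -> : left_act (y * y' : S) (Mnd_to_Vd m) = left_act y (left_act y' (Mnd_to_Vd m)).
    exact: left_actM.
  by rewrite Vd_to_MndK.
have inj : injective psi_map.
  move=> y y' E; apply: val_inj; apply: left_act_inj => v.
  have := congr1 (fun f : wend M => Mnd_to_Vd (f (Vd_to_Mnd v))) E.
  by rewrite /= !Vd_to_MndK.
have surj (f : wend M) : exists y, psi_map y = f.
  have lF : linear (fun v => Mnd_to_Vd (f (Vd_to_Mnd v))).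
    exact: (linear_comp Mnd_to_Vd_linear (linear_comp (wend_linear f) Vd_to_Mnd_linear)).
  have [v w|y [yi yF]] := right_linear_left_act lF.
    by rewrite Vd_to_Mnd_act wend_act Mnd_to_Vd_act sigmaKV.
  by exists (@Defs.Schur k A n d y yi); apply: wendP => m /=; rewrite yF !Mnd_to_VdK.
have [f fK] := choice surj.
by exists f => // y; apply: inj; rewrite fK.
Qed.

End Inverse.
End PermutationModules.

Unset Implicit Arguments.

Theorem corollary5p34 (k : comPzRingType) (A : superalg k)
    (l n d : nat) (eps : bool -> A) (par : 'I_l -> bool) (e : 'I_l -> A)
    (A_free : free_of_finite_rank A)
    (eps_adapted : adapted_pair eps)
    (e_neq0 : forall i, e i != 0)
    (e_orth : forall i j, par i = par j -> e i * e j = if i == j then e i else 0)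
    (e_sum : forall b, eps b = \sum_(i | par i == b) e i)
    (eA_free : forall i, has_homog_basis (fun x : A => exists a : A, x = e i * a))
    (n_gt0 : (0 < n)%N) :
  (exists! sigma : wreath d (ungraded A) -> wreath d A, is_sigma eps sigma) /\
  forall (sigma : wreath d (ungraded A) -> wreath d A)
         (sigma' : wreath d A -> wreath d (ungraded A)),
    is_sigma eps sigma -> cancel sigma sigma' -> cancel sigma' sigma ->
    [/\ forall (y : schur A n d) (lam : ccomp n l d),
          exists h : ccomp n l d -> wreath d A,
            left_act y (v_lam e lam) = \sum_mu right_act (v_lam e mu) (h mu),
        exists! psi : schur A n d -> wend (Mnd n d par e), is_psi sigma' psi
      & forall psi : schur A n d -> wend (Mnd n d par e),
          is_psi sigma' psi -> is_alg_iso psi].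
Proof.
have sS := sigma_map_is_sigma d eps_adapted; split.
  by exists (sigma_map eps); split=> // tau /(is_sigma_inj sS)/funext.
move=> sigma sigma' /(is_sigma_inj sS)/funext <- sK sKV.
have pP := psi_map_is_psi eps_adapted e_orth e_sum sK sKV.
have pU := is_psi_inj eps_adapted e_orth e_sum sK sKV.
split.
- by move=> y lam; apply: (v_lam_span eps_adapted e_orth e_sum sK sKV).
- by exists (psi_map eps_adapted e_orth e_sum sK sKV); split=> // psi /(pU _ _ _ (pP n))/funext.
by move=> psi /(pU _ _ _ (pP n))/funext <-; apply: psi_map_alg_iso.
Qed.
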